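(* Let $(\rho,u,v,p):\mathbb{R}^2\times[0,T)\to\mathbb{R}^4$ be a $C^3$ solution of the linearized Euler equations with constant background state $(\rho',u',v',p')$ (see context). Fix $(x,y)\in\mathbb{R}^2$ and $t\in[0,T)$, and for $\tau>0$ with $t+\tau<T$ put $P=(x,y,t+\tau)$, $P'=(x-u'\tau,\,y-v'\tau,\,t)$ and $Q(\theta)=(x-(u'-c'\cos\theta)\tau,\ y-(v'-c'\sin\theta)\tau,\ t)$. Then, as $\tau\to0^+$, \begin{align*} p(P)&=-p(P')+\frac1\pi\int_0^{2\pi}p(Q(\theta))\,d\theta-\frac{\rho'c'}{2}\big[u(Q(0))-u(Q(\pi))\big]-\frac{\rho'c'}{2}\Big[v\big(Q(\tfrac{\pi}{2})\big)-v\big(Q(\tfrac{3\pi}{2})\big)\Big]+\mathcal O(\tau^3),\\ u(P)&=\frac1\pi\int_0^{2\pi}\Big[u(Q(\theta))\big(2\cos^2\theta-\tfrac12\big)+2v(Q(\theta))\sin\theta\cos\theta\Big]d\theta-\frac{1}{2\rho'c'}\big[p(Q(0))-p(Q(\pi))\big]+\mathcal O(\tau^3),\\ v(P)&=\frac1\pi\int_0^{2\pi}\Big[v(Q(\theta))\big(2\sin^2\theta-\tfrac12\big)+2u(Q(\theta))\sin\theta\cos\theta\Big]d\theta-\frac{1}{2\rho'c'}\Big[p\big(Q(\tfrac{\pi}{2})\big)-p\big(Q(\tfrac{3\pi}{2})\big)\Big]+\mathcal O(\tau^3), \end{align*} and $$\rho(P)=\rho(P')+\frac{1}{c'^2}\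big(p(P)-p(P')\big).$$
   Context: The linearized two-dimensional Euler equations in primitive variables $\mathbf v=(\rho,u,v,p)^T$ with constant background state $(\rho',u',v',p')$, where $\rho'>0$, $p'>0$, $u',v'\in\mathbb{R}$, $\gamma>1$ is the ratio of specific heats and $c'=\sqrt{\gamma p'/\rho'}$, are $\partial_t\mathbf v+A_1\partial_x\mathbf v+A_2\partial_y\mathbf v=0$, i.e. $$\rho_t+u'\rho_x+v'\rho_y+\rho'(u_x+v_y)=0,$$ $$u_t+u'u_x+v'u_y+\tfrac{1}{\rho'}p_x=0,$$ $$v_t+u'v_x+v'v_y+\tfrac{1}{\rho'}p_y=0,$$ $$p_t+u'p_x+v'p_y+\gamma p'(u_x+v_y)=0.$$ Primed quantities are constants; unprimed $\rho,u,v,p$ are the components of the solution. The formulas with the $\mathcal O(\tau^3)$ terms dropped define the approximate evolution operator called $\mathrm{EG}^{\mathrm{quad}}$. The $\mathcal O(\tau^3)$ is for the fixed solution and fixed $(x,y,t)$. *)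

(* Defs.v *)
From Stdlib Require Export Reals.
From Coquelicot Require Export Coquelicot.
Open Scope R_scope.

(* Points (x, y, t) of space-time. *)
Definition point : Type := (R * R * R)%type.

(* R^2 x [0, T) *)
Definition slab (T : R) (X : point) : Prop := 0 <= snd X < T.

(* [is_derive] with [locally t] replaced by its trace on [D]. *)
Definition is_derive_within (D : R -> Prop) (f : R -> R) (t l : R) : Prop :=
  filterdiff f (within D (locally t)) (fun h => scal h l).

(* First-order partial derivatives at a point of the slab; the time derivative
   is the one-sided one when t = 0. *)
Definition is_gradient (T : R) (f : point -> R) (X : point) (fx fy ft : R) : Prop :=
  let '(x, y, t) := X in
  is_derive (fun s => f (s, y, t)) x fx /\
  is_derive (fun s => f (x, s, t)) y fy /\
  is_derive_within (fun s => 0 <= s < T) (fun s => f (x, y, s)) t ft.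

(* f is of class C^k on R^2 x [0, T): all partial derivatives of order at most
   k exist and are continuous, up to and including t = 0.  Values outside the
   slab are irrelevant. *)
Fixpoint class_C (k : nat) (T : R) (f : point -> R) : Prop :=
  continuous_on (slab T) f /\
  match k with
  | O => True
  | S k' =>
      exists fx fy ft : point -> R,
        (forall X, slab T X -> is_gradient T f X (fx X) (fy X) (ft X)) /\
        class_C k' T fx /\ class_C k' T fy /\ class_C k' T ft
  end.

Definition linearized_euler_solution (gamma rho' u' v' p' T : R)
    (rho u v p : point -> R) : Prop :=
  forall X, slab T X ->
  exists rho_x rho_y rho_t u_x u_y u_t v_x v_y v_t p_x p_y p_t : R,
    is_gradient T rho X rho_x rho_y rho_t /\
    is_gradient T u X u_x u_y u_t /\
    is_gradient T v X v_x v_y v_t /\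
    is_gradient T p X p_x p_y p_t /\
    rho_t + u' * rho_x + v' * rho_y + rho' * (u_x + v_y) = 0 /\
    u_t + u' * u_x + v' * u_y + 1 / rho' * p_x = 0 /\
    v_t + u' * v_x + v' * v_y + 1 / rho' * p_y = 0 /\
    p_t + u' * p_x + v' * p_y + gamma * p' * (u_x + v_y) = 0.

Definition is_bigO {S : Type} (F : (S -> Prop) -> Prop) (f g : S -> R) : Prop :=
  exists C : R, F (fun s => Rabs (f s) <= C * Rabs (g s)).

(* Main.v *)
Require Import Defs.
From Stdlib Require Import Reals Lra.
From Coquelicot Require Import Coquelicot.
Open Scope R_scope.

(* In the frame moving with the constant velocity (u', v') the equations become the
   acoustic system p_t = - rho' c'^2 (u_x + v_y), u_t = - p_x / rho', v_t = - p_y / rho',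
   and all data are evaluated on a circle of radius c' tau around the same point P'.
   Differentiating once more in time gives p_tt = c'^2 (p_xx + p_yy),
   u_tt = c'^2 (u_xx + v_xy), v_tt = c'^2 (u_xy + v_yy).  Both sides of each formula are
   then replaced by their second order Taylor polynomials at P': the circle integrals of
   the polynomials reproduce the values and the second time derivatives, and the odd
   differences at opposite points reproduce the first time derivatives.  Since P' itself
   depends on tau, and may lie on the boundary t = 0, the remainders are bounded through
   third derivatives that are locally bounded near the limit point.  The density formula
   holds because rho - p / c'^2 is transported by the mean flow. *)

(** * Continuity and differentiation along curves *)

(** Why the formulas close at order two: first order terms integrate to zero over the circle, even
    against the velocity weights, while a difference at opposite points keeps only odd orders. So
    the integrals supply orders zero and two, the differences supply order one, and the two kinds of
    terms never interfere before the cubic remainder. The factor 1/pi, twice that of the mean, is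
    forced by the second order: [cos ^ 2] and [sin ^ 2] have mean 1/2, so twice the mean of [p]
    contributes exactly the term of [p_tt]; the surplus value of [p] is then removed by [- p(P')].
    Two obstacles shape the proof. At t = 0 time derivatives are one-sided, so every estimate is
    reduced to a mean value inequality that asks for derivatives inside an interval and only
    continuity at its ends. And [p_tt], [u_tt], [v_tt] require exchanging time and space
    derivatives, which the regularity hypothesis provides only as separate functions; Schwarz's
    theorem identifies them for t > 0. *)

Lemma continuous_pair {S U V : UniformSpace} (f : S -> U) (g : S -> V) (s : S) :
  continuous f s -> continuous g s -> continuous (fun r => (f r, g r)) s.
Proof.
  intros Hf Hg.
  apply (continuous_comp_2 f g (fun a b => (a, b))); trivial.
  apply (continuous_ext (fun z => z)); [ now intros [] | apply continuous_id ].
Qed.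

Lemma continuous_along {S : UniformSpace} (F : point -> R) (a b d : S -> R) (s : S) :
  continuous a s -> continuous b s -> continuous d s ->
  continuous F (a s, b s, d s) -> continuous (fun r => F (a r, b r, d r)) s.
Proof.
  intros Ha Hb Hd HF.
  apply (continuous_comp (fun r => (a r, b r, d r)) F); trivial.
  now repeat apply continuous_pair.
Qed.

Lemma continuous_coord1 (X : point) : continuous (fun Y : point => fst (fst Y)) X.
Proof.
  destruct X as [[x y] t].
  apply (continuous_comp fst fst); [ apply continuous_fst | apply continuous_fst ].
Qed.

Lemma continuous_coord2 (X : point) : continuous (fun Y : point => snd (fst Y)) X.
Proof.
  destruct X as [[x y] t].
  apply (continuous_comp fst snd); [ apply continuous_fst | apply continuous_snd ].
Qed.

Lemma continuous_coord3 (X : point) : continuous (fun Y : point => snd Y) X.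
Proof. destruct X; apply continuous_snd. Qed.

Lemma continuous_affine (a b s : R) : continuous (fun r : R => a + b * r) s.
Proof.
  apply (continuous_plus (fun _ => a) (fun r => b * r)).
  - apply continuous_const.
  - apply (continuous_scal_r b (fun r : R => r)), continuous_id.
Qed.

Lemma locally_lt {S : UniformSpace} (f : S -> R) (s : S) (c : R) :
  continuous f s -> f s < c -> locally s (fun r => f r < c).
Proof. intros Hf Hc. exact (Hf _ (open_lt c _ Hc)). Qed.

Lemma locally_gt {S : UniformSpace} (f : S -> R) (s : S) (c : R) :
  continuous f s -> c < f s -> locally s (fun r => c < f r).
Proof. intros Hf Hc. exact (Hf _ (open_gt c _ Hc)). Qed.

(** Chain rule through total differentiability, for which one continuous partial derivative
    suffices: the other, [l], is wanted at a single point. Along a line in space-time the space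
    derivatives play the first role and the time derivative the second. *)
Lemma is_derive_diagonal (f f1 : R -> R -> R) (s l : R) :
  locally (s, s)
    (fun u : R * R => is_derive (fun z => f z (snd u)) (fst u) (f1 (fst u) (snd u))) ->
  is_derive (fun z => f s z) s l ->
  continuous (fun u : R * R => f1 (fst u) (snd u)) (s, s) ->
  is_derive (fun z => f z z) s (f1 s s + l).
Proof.
  intros H1 H2 Hc.
  pose proof (is_derive_filterdiff f s s f1 l H1 H2 Hc) as Hd.
  pose proof (filterdiff_comp'_2 (fun z : R => z) (fun z : R => z) f s
    (fun h => h) (fun h => h) (fun a b => a * f1 s s + b * l)
    (filterdiff_id _) (filterdiff_id _) Hd) as H.
  apply filterdiff_ext_lin with (1 := H).
  intros h; unfold scal; simpl; unfold mult; simpl; ring.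
Qed.

Lemma is_derive_affine_comp (f : R -> R) (a b s l : R) :
  is_derive f (a + b * s) l -> is_derive (fun r => f (a + b * r)) s (b * l).
Proof.
  intros H.
  apply (is_derive_comp f (fun r => a + b * r)); trivial.
  auto_derive; trivial; ring.
Qed.

(** Schwarz's theorem for derivatives given by witnesses, the form in which the regularity
    hypotheses deliver them. *)
Lemma mixed_derivatives_eq (f f1 f2 f12 f21 : R -> R -> R) (x y : R) :
  locally (x, y) (fun u : R * R =>
     is_derive (fun z => f z (snd u)) (fst u) (f1 (fst u) (snd u)) /\
     is_derive (fun z => f (fst u) z) (snd u) (f2 (fst u) (snd u)) /\
     is_derive (fun z => f1 (fst u) z) (snd u) (f12 (fst u) (snd u)) /\
     is_derive (fun z => f2 z (snd u)) (fst u) (f21 (fst u) (snd u))) ->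
  continuous (fun u : R * R => f12 (fst u) (snd u)) (x, y) ->
  continuous (fun u : R * R => f21 (fst u) (snd u)) (x, y) ->
  f12 x y = f21 x y.
Proof.
  intros H C12 C21.
  apply (locally_2d_locally (fun a b =>
     is_derive (fun z => f z b) a (f1 a b) /\
     is_derive (fun z => f a z) b (f2 a b) /\
     is_derive (fun z => f1 a z) b (f12 a b) /\
     is_derive (fun z => f2 z b) a (f21 a b))) in H.
  assert (E : locally_2d (fun a b =>
     is_derive (fun z => Derive (fun s => f s z) a) b (f12 a b) /\
     is_derive (fun z => Derive (fun s => f z s) b) a (f21 a b)) x y).
  (* To differentiate [Derive] it must agree with [f1] or [f2] around each nearby point, not just at
     it; the strong form keeps a whole neighbourhood of (a, b) available. *)
  { apply locally_2d_impl_strong with (2 := H), locally_2d_forall.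
    clear H; intros a b H.
    destruct (locally_2d_singleton _ _ _ H) as (_ & _ & H12 & H21).
    split.
    - apply is_derive_ext_loc with (2 := H12).
      generalize (locally_2d_1d_const_x _ _ _ H).
      apply filter_imp; intros z (Hz & _). symmetry. now apply is_derive_unique.
    - apply is_derive_ext_loc with (2 := H21).
      generalize (locally_2d_1d_const_y _ _ _ H).
      apply filter_imp; intros z (_ & Hz & _). symmetry. now apply is_derive_unique. }
  assert (X : Derive (fun z => Derive (fun t => f z t) y) x =
              Derive (fun z => Derive (fun t => f t z) x) y).
  { apply Schwarz.
    - apply locally_2d_and with (2 := E) in H.
      apply locally_2d_impl with (2 := H), locally_2d_forall.
      intros a b ((Ha & Hb & _ & _) & E1 & E2).
      repeat split; eexists; eassumption.
    - apply continuity_2d_pt_ext_loc with f21.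
      + apply locally_2d_impl with (2 := E), locally_2d_forall.
        intros a b [_ E2]. symmetry; now apply is_derive_unique.
      + now apply continuity_2d_pt_filterlim.
    - apply continuity_2d_pt_ext_loc with f12.
      + apply locally_2d_impl with (2 := E), locally_2d_forall.
        intros a b [E1 _]. symmetry; now apply is_derive_unique.
      + now apply continuity_2d_pt_filterlim. }
  destruct (locally_2d_singleton _ _ _ E) as [E1 E2].
  apply is_derive_unique in E1. apply is_derive_unique in E2.
  now rewrite <- E1, <- E2.
Qed.

(** * Regularity up to the initial time *)

(** Total operators, so that higher space derivatives are written by iteration. Time gets no such
    operator: a function frozen at negative times has derivative 0 there, so [Derive] in time would
    in general jump at t = 0, whereas a witness can be continued continuously. *)
Definition ddx (F : point -> R) (X : point) : R :=
  Derive (fun s => F (s, snd (fst X), snd X)) (fst (fst X)).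

Definition ddy (F : point -> R) (X : point) : R :=
  Derive (fun s => F (fst (fst X), s, snd X)) (snd (fst X)).

(* Continuity and space derivatives are required on the open set [t < T], but time
   derivatives only for [0 < t < T].  This is what survives when a function of class
   C^k on the slab is extended to negative times by its values at [t = 0], and it
   avoids one-sided limits at [t = 0]. *)
Fixpoint smooth (k : nat) (T : R) (F : point -> R) : Prop :=
  (forall x y t, t < T -> continuous F (x, y, t)) /\
  match k with
  | O => True
  | S k' =>
      (forall x y t, t < T ->
         ex_derive (fun s => F (s, y, t)) x /\ ex_derive (fun s => F (x, s, t)) y) /\
      smooth k' T (ddx F) /\ smooth k' T (ddy F) /\
      exists Ft : point -> R,
        (forall x y t, 0 < t < T -> is_derive (fun s => F (x, y, s)) t (Ft (x, y, t))) /\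
        smooth k' T Ft
  end.

Lemma smooth_continuous k T F x y t : smooth k T F -> t < T -> continuous F (x, y, t).
Proof. destruct k; intros [H _]; apply H. Qed.

Lemma smooth_ext k T : forall F G,
  (forall x y t, t < T -> F (x, y, t) = G (x, y, t)) -> smooth k T F -> smooth k T G.
Proof.
  induction k as [|k IH]; intros F G E; simpl.
  all: assert (HC : (forall x y t, t < T -> continuous F (x, y, t)) ->
                    forall x y t, t < T -> continuous G (x, y, t)).
  1, 3: intros H x y t Ht; apply continuous_ext_loc with (2 := H x y t Ht).
  1, 2: generalize (locally_lt (fun Y : point => snd Y) (x, y, t) T
           (continuous_coord3 _) Ht).
  1, 2: apply filter_imp; intros [[a b] s] Hs; now apply E.
  - intros [H _]; auto.
  - intros (H & Hxy & Hddx & Hddy & Ft & Ht & HFt).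
    repeat split; auto.
    + destruct (Hxy x y t H0) as [[l Hl] _]; exists l.
      apply is_derive_ext with (2 := Hl); auto.
    + destruct (Hxy x y t H0) as [_ [l Hl]]; exists l.
      apply is_derive_ext with (2 := Hl); auto.
    + apply IH with (2 := Hddx). intros; apply Derive_ext; simpl; auto.
    + apply IH with (2 := Hddy). intros; apply Derive_ext; simpl; auto.
    + exists Ft; split; trivial. intros x y t Htt.
      apply is_derive_ext_loc with (2 := Ht x y t Htt).
      generalize (locally_lt (fun s : R => s) t T (continuous_id _) (proj2 Htt)).
      apply filter_imp; auto.
Qed.

(** Introduction rule with arbitrary derivative fields: by uniqueness they agree with [ddx F] and
    [ddy F] for t < T, and regularity sees nothing else. *)
Lemma smooth_S k T F Fx Fy Ft :
  (forall x y t, t < T -> continuous F (x, y, t)) ->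
  (forall x y t, t < T -> is_derive (fun s => F (s, y, t)) x (Fx (x, y, t))) ->
  (forall x y t, t < T -> is_derive (fun s => F (x, s, t)) y (Fy (x, y, t))) ->
  (forall x y t, 0 < t < T -> is_derive (fun s => F (x, y, s)) t (Ft (x, y, t))) ->
  smooth k T Fx -> smooth k T Fy -> smooth k T Ft -> smooth (S k) T F.
Proof.
  intros HC Hx Hy Ht Sx Sy St; simpl; repeat split; trivial.
  - eexists; now apply Hx.
  - eexists; now apply Hy.
  - apply smooth_ext with (2 := Sx).
    intros x y t H; symmetry; apply is_derive_unique; now apply Hx.
  - apply smooth_ext with (2 := Sy).
    intros x y t H; symmetry; apply is_derive_unique; now apply Hy.
  - now exists Ft.
Qed.

Lemma smooth_is_derive_x k T F x y t : smooth (S k) T F -> t < T ->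
  is_derive (fun s => F (s, y, t)) x (ddx F (x, y, t)).
Proof. intros (_ & H & _) Ht. apply Derive_correct. exact (proj1 (H x y t Ht)). Qed.

Lemma smooth_is_derive_y k T F x y t : smooth (S k) T F -> t < T ->
  is_derive (fun s => F (x, s, t)) y (ddy F (x, y, t)).
Proof. intros (_ & H & _) Ht. apply Derive_correct. exact (proj2 (H x y t Ht)). Qed.

Lemma smooth_ddx k T F : smooth (S k) T F -> smooth k T (ddx F).
Proof. now intros (_ & _ & H & _). Qed.

Lemma smooth_ddy k T F : smooth (S k) T F -> smooth k T (ddy F).
Proof. now intros (_ & _ & _ & H & _). Qed.

Lemma smooth_time_derivative k T F : smooth (S k) T F -> exists Ft : point -> R,
  (forall x y t, 0 < t < T -> is_derive (fun s => F (x, y, s)) t (Ft (x, y, t))) /\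
  smooth k T Ft.
Proof. now intros (_ & _ & _ & _ & H). Qed.

Lemma smooth_pred k T : forall F, smooth (S k) T F -> smooth k T F.
Proof.
  induction k as [|k IH]; intros F HF.
  - split; trivial. apply HF.
  - destruct (smooth_time_derivative _ _ _ HF) as (Ft & H1 & H2).
    apply smooth_S with (ddx F) (ddy F) Ft; trivial.
    + apply HF.
    + intros; eapply smooth_is_derive_x; eassumption.
    + intros; eapply smooth_is_derive_y; eassumption.
    + apply IH. now apply smooth_ddx.
    + apply IH. now apply smooth_ddy.
    + now apply IH.
Qed.

Lemma continuous_lincomb {S : UniformSpace} (a b : R) (f g : S -> R) (s : S) :
  continuous f s -> continuous g s -> continuous (fun r => a * f r + b * g r) s.
Proof.
  intros Hf Hg.
  apply (continuous_plus (fun r => a * f r) (fun r => b * g r)).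
  - now apply (continuous_scal_r a f).
  - now apply (continuous_scal_r b g).
Qed.

Lemma is_derive_lincomb (a b : R) (f g : R -> R) (s l m : R) :
  is_derive f s l -> is_derive g s m ->
  is_derive (fun r => a * f r + b * g r) s (a * l + b * m).
Proof.
  intros Hf Hg.
  apply (is_derive_plus (fun r => a * f r) (fun r => b * g r)).
  - now apply is_derive_scal.
  - now apply is_derive_scal.
Qed.

Lemma smooth_lincomb k T a b : forall F G,
  smooth k T F -> smooth k T G -> smooth k T (fun X => a * F X + b * G X).
Proof.
  induction k as [|k IH]; intros F G HF HG.
  - split; trivial. intros. apply continuous_lincomb; [ now apply HF | now apply HG ].
  - destruct (smooth_time_derivative _ _ _ HF) as (Ft & F1 & F2).
    destruct (smooth_time_derivative _ _ _ HG) as (Gt & G1 & G2).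
    apply smooth_S with (fun X => a * ddx F X + b * ddx G X)
      (fun X => a * ddy F X + b * ddy G X) (fun X => a * Ft X + b * Gt X).
    + intros. apply continuous_lincomb; [ now apply HF | now apply HG ].
    + intros; apply (is_derive_lincomb a b (fun s => F (s, y, t)) (fun s => G (s, y, t)));
        eapply smooth_is_derive_x; eassumption.
    + intros; apply (is_derive_lincomb a b (fun s => F (x, s, t)) (fun s => G (x, s, t)));
        eapply smooth_is_derive_y; eassumption.
    + intros; apply (is_derive_lincomb a b (fun s => F (x, y, s)) (fun s => G (x, y, s)));
        auto.
    + apply IH; now apply smooth_ddx.
    + apply IH; now apply smooth_ddy.
    + now apply IH.
Qed.

Lemma is_derive_spatial_line T F a b x y t s : smooth 1 T F -> t < T ->
  is_derive (fun r => F (x + a * r, y + b * r, t)) s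
    (a * ddx F (x + a * s, y + b * s, t) + b * ddy F (x + a * s, y + b * s, t)).
Proof.
  intros HF Ht.
  apply (is_derive_diagonal (fun r1 r2 => F (x + a * r1, y + b * r2, t))
    (fun r1 r2 => a * ddx F (x + a * r1, y + b * r2, t))).
  - apply filter_forall; intros [r1 r2]; simpl.
    apply (is_derive_affine_comp (fun z => F (z, y + b * r2, t))).
    now apply smooth_is_derive_x with (1 := HF).
  - apply (is_derive_affine_comp (fun z => F (x + a * s, z, t))).
    now apply smooth_is_derive_y with (1 := HF).
  - apply (continuous_scal_r a (fun u : R * R =>
             ddx F (x + a * fst u, y + b * snd u, t))).
    apply (continuous_along (ddx F) (fun u : R * R => x + a * fst u)
             (fun u => y + b * snd u) (fun _ => t)).
    + apply (continuous_comp fst (fun r : R => x + a * r));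
        [ apply continuous_fst | apply continuous_affine ].
    + apply (continuous_comp snd (fun r : R => y + b * r));
        [ apply continuous_snd | apply continuous_affine ].
    + apply continuous_const.
    + apply smooth_continuous with (2 := Ht) (k := O). now apply smooth_ddx.
Qed.

Lemma is_derive_spacetime_line T F a b x y t l : smooth 1 T F -> 0 < t < T ->
  is_derive (fun s => F (x + a * t, y + b * t, s)) t l ->
  is_derive (fun s => F (x + a * s, y + b * s, s)) t
    (a * ddx F (x + a * t, y + b * t, t) + b * ddy F (x + a * t, y + b * t, t) + l).
Proof.
  intros HF Ht Hl.
  apply (is_derive_diagonal (fun r1 r2 => F (x + a * r1, y + b * r1, r2))
    (fun r1 r2 => a * ddx F (x + a * r1, y + b * r1, r2)
                  + b * ddy F (x + a * r1, y + b * r1, r2))).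
  - generalize (locally_lt (fun u : R * R => snd u) (t, t) T
      (continuous_snd _ _) (proj2 Ht)).
    apply filter_imp; intros [r1 r2] Hr; simpl in *.
    now apply is_derive_spatial_line with (1 := HF).
  - exact Hl.
  - apply continuous_lincomb.
    + apply (continuous_along (ddx F) (fun u : R * R => x + a * fst u)
             (fun u => y + b * fst u) (fun u => snd u)).
      1, 2: apply (continuous_comp fst (fun r : R => _ + _ * r));
        [ apply continuous_fst | apply continuous_affine ].
      * apply continuous_snd.
      * apply smooth_continuous with (2 := proj2 Ht) (k := O). now apply smooth_ddx.
    + apply (continuous_along (ddy F) (fun u : R * R => x + a * fst u)
             (fun u => y + b * fst u) (fun u => snd u)).
      1, 2: apply (continuous_comp fst (fun r : R => _ + _ * r));
        [ apply continuous_fst | apply continuous_affine ].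
      * apply continuous_snd.
      * apply smooth_continuous with (2 := proj2 Ht) (k := O). now apply smooth_ddy.
Qed.

(** Time derivatives in these coordinates are material derivatives [F_t + a F_x + b F_y]. *)
Definition moving_frame (a b : R) (F : point -> R) (X : point) : R :=
  F (fst (fst X) + a * snd X, snd (fst X) + b * snd X, snd X).

Lemma is_derive_shift (f : R -> R) (c s l : R) :
  is_derive f (s + c) l -> is_derive (fun r => f (r + c)) s l.
Proof.
  intros H.
  apply is_derive_ext with (fun r => f (c + 1 * r)); [ intros; f_equal; ring | ].
  rewrite <- (Rmult_1_l l).
  apply is_derive_affine_comp. now replace (c + 1 * s) with (s + c) by ring.
Qed.

Lemma moving_frame_is_derive_x T F a b x y t : smooth 1 T F -> t < T ->
  is_derive (fun s => moving_frame a b F (s, y, t)) x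
    (moving_frame a b (ddx F) (x, y, t)).
Proof.
  intros HF Ht.
  refine (is_derive_shift (fun s => F (s, y + b * t, t)) (a * t) x _ _).
  exact (smooth_is_derive_x _ _ _ _ _ _ HF Ht).
Qed.

Lemma moving_frame_is_derive_y T F a b x y t : smooth 1 T F -> t < T ->
  is_derive (fun s => moving_frame a b F (x, s, t)) y
    (moving_frame a b (ddy F) (x, y, t)).
Proof.
  intros HF Ht.
  refine (is_derive_shift (fun s => F (x + a * t, s, t)) (b * t) y _ _).
  exact (smooth_is_derive_y _ _ _ _ _ _ HF Ht).
Qed.

Lemma smooth_le1 k T F : smooth (S k) T F -> smooth 1 T F.
Proof. induction k; trivial. intros H. now apply IHk, smooth_pred. Qed.

Lemma smooth_moving_frame k T a b : forall F,
  smooth k T F -> smooth k T (moving_frame a b F).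
Proof.
  induction k as [|k IH]; intros F HF.
  all: assert (HC : forall x y t, t < T -> continuous (moving_frame a b F) (x, y, t)).
  1, 3: intros x y t Ht; unfold moving_frame.
  1, 2: apply (continuous_along F (fun X : point => fst (fst X) + a * snd X)
         (fun X => snd (fst X) + b * snd X) (fun X => snd X)).
  1, 5: apply (continuous_plus (fun X : point => fst (fst X)) (fun X => a * snd X));
    [ apply continuous_coord1
    | apply (continuous_scal_r a (fun X : point => snd X)), continuous_coord3 ].
  1, 4: apply (continuous_plus (fun X : point => snd (fst X)) (fun X => b * snd X));
    [ apply continuous_coord2
    | apply (continuous_scal_r b (fun X : point => snd X)), continuous_coord3 ].
  1, 3: apply continuous_coord3.
  1, 2: now apply smooth_continuous with (1 := HF).
  - now split.
  - assert (HF1 := smooth_le1 _ _ _ HF).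
    destruct (smooth_time_derivative _ _ _ HF) as (Ft & F1 & F2).
    (* The time witness is the material derivative; the factors 1 give it the shape required by
       [smooth_lincomb]. *)
    apply smooth_S with (moving_frame a b (ddx F)) (moving_frame a b (ddy F))
      (moving_frame a b (fun X => 1 * (a * ddx F X + b * ddy F X) + 1 * Ft X)); trivial.
    + intros; now apply moving_frame_is_derive_x with T.
    + intros; now apply moving_frame_is_derive_y with T.
    + intros x y t Ht. unfold moving_frame; cbn [fst snd]; rewrite !Rmult_1_l.
      apply is_derive_spacetime_line with T; trivial. now apply F1.
    + now apply IH, smooth_ddx.
    + now apply IH, smooth_ddy.
    + apply IH. apply smooth_lincomb; trivial.
      apply smooth_lincomb; [ now apply smooth_ddx | now apply smooth_ddy ].
Qed.

(** [smooth] gives [ddx F] a time derivative [H] with no stated link to [G]. Both are continuous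
    mixed derivatives of [F] near a point with t > 0, hence equal. *)
Lemma is_derive_t_ddx T F G x y t : smooth 2 T F ->
  (forall x y t, 0 < t < T -> is_derive (fun s => F (x, y, s)) t (G (x, y, t))) ->
  smooth 1 T G -> 0 < t < T ->
  is_derive (fun s => ddx F (x, y, s)) t (ddx G (x, y, t)).
Proof.
  intros HF HG SG Ht.
  destruct (smooth_time_derivative _ _ _ (smooth_ddx _ _ _ HF)) as (H & H1 & H2).
  replace (ddx G (x, y, t)) with (H (x, y, t)); [ now apply H1 | ].
  apply (mixed_derivatives_eq (fun a s => F (a, y, s)) (fun a s => ddx F (a, y, s))
    (fun a s => G (a, y, s)) (fun a s => H (a, y, s)) (fun a s => ddx G (a, y, s))).
  - generalize (filter_and _ _
      (locally_lt (fun u : R * R => snd u) (x, t) T (continuous_snd _ _) (proj2 Ht))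
      (locally_gt (fun u : R * R => snd u) (x, t) 0 (continuous_snd _ _) (proj1 Ht))).
    apply filter_imp; intros [a s] [Hs Hs']; simpl in Hs, Hs' |- *.
    split; [ now apply smooth_is_derive_x with (1 := HF) | ].
    split; [ now apply HG | ].
    split; [ now apply H1 | ].
    now apply smooth_is_derive_x with (1 := SG).
  - apply (continuous_along H (fun u : R * R => fst u) (fun _ => y) (fun u => snd u)).
    + apply continuous_fst.
    + apply continuous_const.
    + apply continuous_snd.
    + now apply smooth_continuous with (1 := H2).
  - apply (continuous_along (ddx G) (fun u : R * R => fst u) (fun _ => y) (fun u => snd u)).
    + apply continuous_fst.
    + apply continuous_const.
    + apply continuous_snd.
    + now apply smooth_continuous with (1 := smooth_ddx _ _ _ SG).
Qed.

Lemma is_derive_t_ddy T F G x y t : smooth 2 T F ->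
  (forall x y t, 0 < t < T -> is_derive (fun s => F (x, y, s)) t (G (x, y, t))) ->
  smooth 1 T G -> 0 < t < T ->
  is_derive (fun s => ddy F (x, y, s)) t (ddy G (x, y, t)).
Proof.
  intros HF HG SG Ht.
  destruct (smooth_time_derivative _ _ _ (smooth_ddy _ _ _ HF)) as (H & H1 & H2).
  replace (ddy G (x, y, t)) with (H (x, y, t)); [ now apply H1 | ].
  apply (mixed_derivatives_eq (fun a s => F (x, a, s)) (fun a s => ddy F (x, a, s))
    (fun a s => G (x, a, s)) (fun a s => H (x, a, s)) (fun a s => ddy G (x, a, s))).
  - generalize (filter_and _ _
      (locally_lt (fun u : R * R => snd u) (y, t) T (continuous_snd _ _) (proj2 Ht))
      (locally_gt (fun u : R * R => snd u) (y, t) 0 (continuous_snd _ _) (proj1 Ht))).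
    apply filter_imp; intros [a s] [Hs Hs']; simpl in Hs, Hs' |- *.
    split; [ now apply smooth_is_derive_y with (1 := HF) | ].
    split; [ now apply HG | ].
    split; [ now apply H1 | ].
    now apply smooth_is_derive_y with (1 := SG).
  - apply (continuous_along H (fun _ => x) (fun u : R * R => fst u) (fun u => snd u)).
    + apply continuous_const.
    + apply continuous_fst.
    + apply continuous_snd.
    + now apply smooth_continuous with (1 := H2).
  - apply (continuous_along (ddy G) (fun _ => x) (fun u : R * R => fst u) (fun u => snd u)).
    + apply continuous_const.
    + apply continuous_fst.
    + apply continuous_snd.
    + now apply smooth_continuous with (1 := smooth_ddy _ _ _ SG).
Qed.

Lemma ddy_ddx T F x y t : smooth 2 T F -> t < T ->
  ddy (ddx F) (x, y, t) = ddx (ddy F) (x, y, t).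
Proof.
  intros HF Ht.
  assert (Sx := smooth_ddx _ _ _ HF). assert (Sy := smooth_ddy _ _ _ HF).
  apply (mixed_derivatives_eq (fun a b => F (a, b, t)) (fun a b => ddx F (a, b, t))
    (fun a b => ddy F (a, b, t)) (fun a b => ddy (ddx F) (a, b, t))
    (fun a b => ddx (ddy F) (a, b, t))).
  - apply filter_forall; intros [a b]; simpl.
    split; [ now apply smooth_is_derive_x with (1 := HF) | ].
    split; [ now apply smooth_is_derive_y with (1 := HF) | ].
    split; [ now apply smooth_is_derive_y with (1 := Sx) | ].
    now apply smooth_is_derive_x with (1 := Sy).
  - apply (continuous_along (ddy (ddx F)) (fun u : R * R => fst u) (fun u => snd u)
             (fun _ => t)).
    + apply continuous_fst.
    + apply continuous_snd.
    + apply continuous_const.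
    + now apply smooth_continuous with (1 := smooth_ddy _ _ _ Sx).
  - apply (continuous_along (ddx (ddy F)) (fun u : R * R => fst u) (fun u => snd u)
             (fun _ => t)).
    + apply continuous_fst.
    + apply continuous_snd.
    + apply continuous_const.
    + now apply smooth_continuous with (1 := smooth_ddx _ _ _ Sy).
Qed.

(** * Taylor estimates with locally uniform remainder *)

(** The derivative is confined to the open interval because the left end may be the initial time. *)
Lemma mean_value_bound (h h' : R -> R) (b K : R) : 0 < b ->
  (forall s, 0 < s < b -> is_derive h s (h' s)) ->
  (forall s, 0 <= s <= b -> continuous h s) ->
  (forall s, 0 < s < b -> Rabs (h' s) <= K) ->
  Rabs (h b - h 0) <= K * b.
Proof.
  intros Hb Hd Hc HK.
  assert (K0 : 0 <= K) by (apply Rle_trans with (2 := HK (b / 2) ltac:(lra)), Rabs_pos).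
  (* [MVT_gen] may return an end point, where [h'] is not controlled *)
  destruct (MVT_gen h 0 b (fun s => if Rlt_dec 0 s then
      if Rlt_dec s b then h' s else 0 else 0)) as (c & Hcb & ->).
  - rewrite Rmin_left, Rmax_right by lra. intros s Hs.
    destruct (Rlt_dec 0 s); [ | lra ]. destruct (Rlt_dec s b); [ auto | lra ].
  - rewrite Rmin_left, Rmax_right by lra. intros s Hs.
    apply continuity_pt_filterlim. now apply Hc.
  - rewrite Rabs_mult, (Rabs_right (b - 0)), Rminus_0_r by lra.
    apply Rmult_le_compat_r; [ lra | ].
    destruct (Rlt_dec 0 c); [ | rewrite Rabs_R0; lra ].
    destruct (Rlt_dec c b); [ auto | rewrite Rabs_R0; lra ].
Qed.

(** The mean value inequality is applied to [g2], then [g1], then [g], each time after subtracting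
    the polynomial part. Each pass costs a factor [b], which gives the constant [M] where Lagrange's
    remainder would give M/6. *)
Lemma taylor2_bound (g g1 g2 g3 : R -> R) (b M : R) : 0 < b ->
  (forall s, 0 < s < b -> is_derive g s (g1 s)) ->
  (forall s, 0 < s < b -> is_derive g1 s (g2 s)) ->
  (forall s, 0 < s < b -> is_derive g2 s (g3 s)) ->
  (forall s, 0 <= s <= b -> continuous g s) ->
  (forall s, 0 <= s <= b -> continuous g1 s) ->
  (forall s, 0 <= s <= b -> continuous g2 s) ->
  (forall s, 0 < s < b -> Rabs (g3 s) <= M) ->
  Rabs (g b - (g 0 + b * g1 0 + b ^ 2 / 2 * g2 0)) <= M * b ^ 3.
Proof.
  intros Hb D1 D2 D3 C0 C1 C2 HM.
  assert (M0 : 0 <= M) by (apply Rle_trans with (2 := HM (b / 2) ltac:(lra)), Rabs_pos).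
  assert (L : forall c : R, forall s : R, continuous (fun r : R => c * r) s).
  { intros. apply (continuous_scal_r c (fun r : R => r)), continuous_id. }
  assert (B2 : forall s, 0 < s < b -> Rabs (g2 s - g2 0) <= M * b).
  { intros s Hs. apply Rle_trans with (M * s); [ | nra ].
    apply mean_value_bound with g3; [ lra | | | ].
    - intros; apply D3; lra.
    - intros; apply C2; lra.
    - intros; apply HM; lra. }
  assert (B1 : forall s, 0 < s < b -> Rabs (g1 s - g2 0 * s - g1 0) <= M * b * b).
  { intros s Hs. apply Rle_trans with (M * b * s); [ | apply Rmult_le_compat_l; nra ].
    replace (g1 s - g2 0 * s - g1 0) with
      ((g1 s - g2 0 * s) - (g1 0 - g2 0 * 0)) by ring.
    apply (mean_value_bound (fun r => g1 r - g2 0 * r) (fun r => g2 r - g2 0)); [ lra | | | ].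
    - intros r Hr. apply (is_derive_minus g1 (fun r => g2 0 * r)).
      + apply D2; lra.
      + auto_derive; trivial; ring.
    - intros r Hr. apply (continuous_minus g1 (fun r => g2 0 * r)); [ | apply L ].
      apply C1; lra.
    - intros; apply B2; lra. }
  replace (g b - (g 0 + b * g1 0 + b ^ 2 / 2 * g2 0)) with
    ((g b - (g1 0 * b + g2 0 / 2 * b ^ 2)) - (g 0 - (g1 0 * 0 + g2 0 / 2 * 0 ^ 2)))
    by field.
  replace (M * b ^ 3) with (M * b * b * b) by ring.
  apply (mean_value_bound (fun r => g r - (g1 0 * r + g2 0 / 2 * r ^ 2))
    (fun r => g1 r - (g1 0 + g2 0 * r))); trivial.
  - intros r Hr. apply (is_derive_minus g (fun r => g1 0 * r + g2 0 / 2 * r ^ 2)).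
    + now apply D1.
    + auto_derive; trivial; field.
  - intros r Hr.
    apply (continuous_minus g (fun r => g1 0 * r + g2 0 / 2 * r ^ 2)); [ now apply C0 | ].
    apply (ex_derive_continuous (fun r => g1 0 * r + g2 0 / 2 * r ^ 2)).
    now auto_derive.
  - intros r Hr. replace (g1 r - (g1 0 + g2 0 * r)) with (g1 r - g2 0 * r - g1 0) by ring.
    now apply B1.
Qed.

Definition near (r x y x' y' : R) : Prop := Rabs (x' - x) < r /\ Rabs (y' - y) < r.

Lemma near_weaken r1 r2 x y x' y' : r1 <= r2 -> near r1 x y x' y' -> near r2 x y x' y'.
Proof. unfold near; lra. Qed.

Lemma locally_bounded T F x y t : smooth 0 T F -> t < T ->
  exists r M, 0 < r /\ 0 <= M /\ forall x' y' t',
    near r x y x' y' -> Rabs (t' - t) < r -> Rabs (F (x', y', t')) <= M.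
Proof.
  intros [HF _] Ht.
  destruct (HF x y t Ht _ (locally_ball (F (x, y, t)) (mkposreal 1 Rlt_0_1)))
    as [r Hr].
  exists r, (Rabs (F (x, y, t)) + 1). split; [ apply cond_pos | ].
  split; [ generalize (Rabs_pos (F (x, y, t))); lra | ].
  intros x' y' t' [Hx Hy] Hs.
  assert (E : Rabs (F (x', y', t') - F (x, y, t)) < 1).
  { apply (Hr (x', y', t')). repeat split; assumption. }
  generalize (Rabs_triang (F (x', y', t') - F (x, y, t)) (F (x, y, t))).
  replace (F (x', y', t') - F (x, y, t) + F (x, y, t)) with (F (x', y', t')) by ring.
  lra.
Qed.

Lemma continuous_in_time T F x y t : smooth 0 T F -> t < T ->
  continuous (fun s => F (x, y, s)) t.
Proof.
  intros [HF _] Ht.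
  apply (continuous_along F (fun _ => x) (fun _ => y) (fun s : R => s)).
  - apply continuous_const.
  - apply continuous_const.
  - apply continuous_id.
  - now apply HF.
Qed.

Lemma continuous_on_spatial_line T F a b x y t s : smooth 0 T F -> t < T ->
  continuous (fun s => F (x + a * s, y + b * s, t)) s.
Proof.
  intros [HF _] Ht.
  apply (continuous_along F (fun s => x + a * s) (fun s => y + b * s) (fun _ => t)).
  - apply continuous_affine.
  - apply continuous_affine.
  - apply continuous_const.
  - now apply HF.
Qed.

Lemma time_taylor T F G H x y t : smooth 0 T F -> smooth 0 T G -> smooth 1 T H ->
  (forall x y t, 0 < t < T -> is_derive (fun s => F (x, y, s)) t (G (x, y, t))) ->
  (forall x y t, 0 < t < T -> is_derive (fun s => G (x, y, s)) t (H (x, y, t))) ->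
  0 <= t < T ->
  exists r C, 0 < r /\ forall x' y' tau, near r x y x' y' -> 0 < tau < r ->
    Rabs (F (x', y', t + tau) - (F (x', y', t) + tau * G (x', y', t)
            + tau ^ 2 / 2 * H (x', y', t))) <= C * tau ^ 3.
Proof.
  intros SF SG SH DF DG Ht.
  destruct (smooth_time_derivative _ _ _ SH) as (K & DH & SK).
  destruct (locally_bounded T K x y t SK (proj2 Ht)) as (r & M & Hr & _ & HM).
  (* [T - t] keeps the whole segment from t to t + tau below [T]. *)
  exists (Rmin r (T - t)), M. split; [ apply Rmin_glb_lt; lra | ].
  intros x' y' tau Hn Htau.
  assert (H1 := Rmin_l r (T - t)). assert (H2 := Rmin_r r (T - t)).
  assert (E : forall L : point -> R, L (x', y', t) = L (x', y', t + 0))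
    by (intros; now rewrite Rplus_0_r).
  rewrite (E F), (E G), (E H).
  assert (CC : forall L s, smooth 0 T L -> 0 <= s <= tau ->
     continuous (fun s => L (x', y', t + s)) s).
  { intros L s HL Hs.
    apply (continuous_comp (fun s => t + s) (fun r => L (x', y', r))).
    - apply (continuous_plus (fun _ => t) (fun s : R => s));
        [ apply continuous_const | apply continuous_id ].
    - apply continuous_in_time with T; trivial; lra. }
  assert (DD : forall L L' : point -> R,
     (forall x y t, 0 < t < T -> is_derive (fun s => L (x, y, s)) t (L' (x, y, t))) ->
     forall s, 0 < s < tau -> is_derive (fun s => L (x', y', t + s)) s (L' (x', y', t + s))).
  { intros L L' HL s Hs.
    apply is_derive_ext with (fun s => L (x', y', s + t));
      [ intros; now rewrite Rplus_comm | ].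
    refine (is_derive_shift (fun s => L (x', y', s)) t s _ _).
    rewrite (Rplus_comm t s). apply HL; lra. }
  refine (taylor2_bound (fun s => F (x', y', t + s)) (fun s => G (x', y', t + s))
    (fun s => H (x', y', t + s)) (fun s => K (x', y', t + s)) tau M _ _ _ _ _ _ _ _).
  - lra.
  - now apply DD.
  - now apply DD.
  - now apply DD.
  - intros; now apply CC.
  - intros; now apply CC.
  - intros; apply CC; trivial; now apply smooth_pred.
  - intros s Hs. apply HM.
    + now apply near_weaken with (2 := Hn).
    + replace (t + s - t) with s by ring. rewrite Rabs_right; lra.
Qed.

(** Applied to the second derivatives of a function, this bounds its third derivatives uniformly in
    the base point and in the direction (a, b). *)
Lemma gradient_locally_bounded T F x y t : smooth 1 T F -> t < T ->
  exists r M, 0 < r /\ 0 <= M /\ forall x' y' a b,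
    near r x y x' y' -> Rabs a <= 1 -> Rabs b <= 1 ->
    Rabs (a * ddx F (x', y', t) + b * ddy F (x', y', t)) <= M.
Proof.
  intros SF Ht.
  destruct (locally_bounded T _ x y t (smooth_ddx _ _ _ SF) Ht) as (r1 & M1 & R1 & P1 & H1).
  destruct (locally_bounded T _ x y t (smooth_ddy _ _ _ SF) Ht) as (r2 & M2 & R2 & P2 & H2).
  exists (Rmin r1 r2), (M1 + M2).
  split; [ now apply Rmin_glb_lt | split; [ lra | ] ].
  intros x' y' a b Hn Ha Hb.
  assert (K1 : Rabs (ddx F (x', y', t)) <= M1).
  { apply H1; [ apply near_weaken with (2 := Hn), Rmin_l | ].
    now rewrite Rminus_diag, Rabs_R0. }
  assert (K2 : Rabs (ddy F (x', y', t)) <= M2).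
  { apply H2; [ apply near_weaken with (2 := Hn), Rmin_r | ].
    now rewrite Rminus_diag, Rabs_R0. }
  apply Rle_trans with (1 := Rabs_triang _ _).
  rewrite !Rabs_mult.
  generalize (Rabs_pos (ddx F (x', y', t))) (Rabs_pos (ddy F (x', y', t)))
    (Rabs_pos a) (Rabs_pos b).
  nra.
Qed.

Lemma spatial_taylor T F x y t : smooth 3 T F -> t < T ->
  exists r C, 0 < r /\ forall x' y' a b tau,
    near r x y x' y' -> 0 < tau < r -> Rabs a <= 1 -> Rabs b <= 1 ->
    Rabs (F (x' + a * tau, y' + b * tau, t)
      - (F (x', y', t) + tau * (a * ddx F (x', y', t) + b * ddy F (x', y', t))
         + tau ^ 2 / 2 * (a ^ 2 * ddx (ddx F) (x', y', t)
             + 2 * a * b * ddx (ddy F) (x', y', t)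
             + b ^ 2 * ddy (ddy F) (x', y', t)))) <= C * tau ^ 3.
Proof.
  intros S3 Ht.
  assert (S2 := smooth_pred _ _ _ S3). assert (S1 := smooth_pred _ _ _ S2).
  assert (Sx := smooth_ddx _ _ _ S3). assert (Sy := smooth_ddy _ _ _ S3).
  assert (Sxx := smooth_ddx _ _ _ Sx). assert (Sxy := smooth_ddx _ _ _ Sy).
  assert (Syy := smooth_ddy _ _ _ Sy).
  destruct (gradient_locally_bounded _ _ x y t Sxx Ht) as (r1 & M1 & R1 & P1 & H1).
  destruct (gradient_locally_bounded _ _ x y t Sxy Ht) as (r2 & M2 & R2 & P2 & H2).
  destruct (gradient_locally_bounded _ _ x y t Syy Ht) as (r3 & M3 & R3 & P3 & H3).
  set (r := Rmin r1 (Rmin r2 r3)).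
  assert (Hr : 0 < r) by now repeat apply Rmin_glb_lt.
  assert (L1 : r <= r1) by apply Rmin_l.
  assert (L2 : r <= r2) by apply (Rle_trans _ _ _ (Rmin_r _ _)), Rmin_l.
  assert (L3 : r <= r3) by apply (Rle_trans _ _ _ (Rmin_r _ _)), Rmin_r.
  clearbody r.
  (* Half of the radius is for the base point and half for the displacement. The weights 1, 2, 1 are
     those of [a ^ 2], [2 * a * b], [b ^ 2] when a and b are at most 1 in absolute value. *)
  exists (r / 2), (M1 + 2 * M2 + M3). split; [ lra | ].
  intros x' y' a b tau [Hx Hy] Htau Ha Hb.
  assert (Hn : forall s, 0 < s < tau -> near r x y (x' + a * s) (y' + b * s)).
  { intros s Hs; split.
    - apply Rabs_def2 in Hx; apply Rabs_le_between in Ha. apply Rabs_def1; nra.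
    - apply Rabs_def2 in Hy; apply Rabs_le_between in Hb. apply Rabs_def1; nra. }
  assert (E : forall L : point -> R, L (x', y', t) = L (x' + a * 0, y' + b * 0, t))
    by (intros; f_equal; f_equal; f_equal; ring).
  rewrite (E F), (E (ddx F)), (E (ddy F)), (E (ddx (ddx F))), (E (ddx (ddy F))), (E (ddy (ddy F))).
  clear E.
  set (l := fun (L : point -> R) s => L (x' + a * s, y' + b * s, t)).
  assert (DD : forall L s, smooth 1 T L ->
    is_derive (l L) s (a * l (ddx L) s + b * l (ddy L) s)).
  { intros L s HL. now apply (is_derive_spatial_line T). }
  assert (CC : forall L s, smooth 0 T L -> continuous (l L) s).
  { intros L s HL. now apply (continuous_on_spatial_line T). }
  refine (taylor2_bound (l F) (fun s => a * l (ddx F) s + b * l (ddy F) s)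
    (fun s => a ^ 2 * l (ddx (ddx F)) s + 2 * a * b * l (ddx (ddy F)) s
              + b ^ 2 * l (ddy (ddy F)) s)
    (fun s => a ^ 2 * (a * l (ddx (ddx (ddx F))) s + b * l (ddy (ddx (ddx F))) s)
       + 2 * a * b * (a * l (ddx (ddx (ddy F))) s + b * l (ddy (ddx (ddy F))) s)
       + b ^ 2 * (a * l (ddx (ddy (ddy F))) s + b * l (ddy (ddy (ddy F))) s))
    tau (M1 + 2 * M2 + M3) _ _ _ _ _ _ _ _).
  - lra.
  - intros; now apply DD.
  - intros s Hs.
    (* Differentiating the directional derivative yields both mixed derivatives; [ddy_ddx] merges
       them into the coefficient [2 * a * b]. *)
    replace (a ^ 2 * l (ddx (ddx F)) s + 2 * a * b * l (ddx (ddy F)) s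
              + b ^ 2 * l (ddy (ddy F)) s) with
      (a * (a * l (ddx (ddx F)) s + b * l (ddy (ddx F)) s)
       + b * (a * l (ddx (ddy F)) s + b * l (ddy (ddy F)) s)).
    + apply is_derive_lincomb; apply DD; now apply smooth_pred.
    + unfold l; rewrite (ddy_ddx T) by trivial. ring.
  - intros s Hs.
    apply (is_derive_plus (fun s => a ^ 2 * l (ddx (ddx F)) s + 2 * a * b * l (ddx (ddy F)) s)
             (fun s => b ^ 2 * l (ddy (ddy F)) s)).
    + apply is_derive_lincomb; now apply DD.
    + apply is_derive_scal; now apply DD.
  - intros; apply CC. now apply smooth_pred.
  - intros; apply continuous_lincomb; apply CC.
    + now apply smooth_ddx.
    + now apply smooth_ddy.
  - intros.
    apply (continuous_plus (fun s => a ^ 2 * l (ddx (ddx F)) s + 2 * a * b * l (ddx (ddy F)) s)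
             (fun s => b ^ 2 * l (ddy (ddy F)) s)).
    + apply continuous_lincomb; apply CC; now apply smooth_pred.
    + apply (continuous_scal_r (b ^ 2) (l (ddy (ddy F)))), CC. now apply smooth_pred.
  - intros s Hs. specialize (Hn s Hs).
    assert (K1 := H1 _ _ a b (near_weaken _ _ _ _ _ _ L1 Hn) Ha Hb).
    assert (K2 := H2 _ _ a b (near_weaken _ _ _ _ _ _ L2 Hn) Ha Hb).
    assert (K3 := H3 _ _ a b (near_weaken _ _ _ _ _ _ L3 Hn) Ha Hb).
    fold (l (ddx (ddx (ddx F))) s) (l (ddy (ddx (ddx F))) s) in K1.
    fold (l (ddx (ddx (ddy F))) s) (l (ddy (ddx (ddy F))) s) in K2.
    fold (l (ddx (ddy (ddy F))) s) (l (ddy (ddy (ddy F))) s) in K3.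
    set (A1 := _ + _) in K1 |- *. set (A2 := _ + _) in K2 |- *. set (A3 := _ + _) in K3 |- *.
    assert (W : forall k z M, Rabs k <= 1 -> Rabs z <= M -> Rabs (k * z) <= M).
    { intros k z M Hk Hz. rewrite Rabs_mult. generalize (Rabs_pos k) (Rabs_pos z). nra. }
    replace (a ^ 2 * A1 + 2 * a * b * A2 + b ^ 2 * A3) with
      (a * (a * A1) + 2 * (a * (b * A2)) + b * (b * A3)) by ring.
    apply Rle_trans with (1 := Rabs_triang _ _), Rplus_le_compat; [ | auto ].
    apply Rle_trans with (1 := Rabs_triang _ _), Rplus_le_compat; [ auto | ].
    rewrite Rabs_mult, (Rabs_right 2) by lra.
    apply Rmult_le_compat_l; [ lra | auto ].
Qed.

(** * Second order expansions of the evolution formulas *)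

Lemma sin_sqr th : sin th ^ 2 = 1 - cos th ^ 2.
Proof. rewrite <- (sin2_cos2 th); unfold Rsqr; ring. Qed.

(* Modulo [sin^2 = 1 - cos^2], every trigonometric polynomial of degree at most 4
   has this form. *)
Lemma is_RInt_trig_poly (k0 k1 k2 k3 k4 k5 k6 k7 k8 : R) :
  is_RInt (fun th => k0 + k1 * cos th + k2 * sin th + k3 * cos th ^ 2
      + k4 * (cos th * sin th) + k5 * cos th ^ 3 + k6 * (cos th ^ 2 * sin th)
      + k7 * cos th ^ 4 + k8 * (cos th ^ 3 * sin th)) 0 (2 * PI)
    (2 * PI * k0 + PI * k3 + 3 * PI / 4 * k7).
Proof.
  (* A termwise antiderivative. Only the terms in [k0], [k3], [k7] contain a multiple of [th]; the
     rest is periodic and cancels between the end points. *)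
  set (f := fun th => k0 * th + k1 * sin th - k2 * cos th
    + k3 * (th / 2 + sin th * cos th / 2) - k4 * (cos th ^ 2 / 2)
    + k5 * (sin th - sin th ^ 3 / 3) - k6 * (cos th ^ 3 / 3)
    + k7 * (3 * th / 8 + cos th ^ 3 * sin th / 4 + 3 * (cos th * sin th) / 8)
    - k8 * (cos th ^ 4 / 4)).
  replace (2 * PI * k0 + PI * k3 + 3 * PI / 4 * k7) with (minus (f (2 * PI)) (f 0)).
  - apply (is_RInt_derive f).
    + intros th _. unfold f. auto_derive; trivial.
      field [(sin_sqr th)].
    + intros th _. apply (ex_derive_continuous (V := R_NormedModule)). now auto_derive.
  - unfold f, minus, plus, opp; simpl.
    rewrite sin_2PI, cos_2PI, sin_0, cos_0. field.
Qed.

(** The factor 2 is the length 2 pi of the interval divided by pi. *)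
Lemma circle_mean_bound (h k : R -> R) (I eps : R) :
  (forall th, continuous h th) -> is_RInt k 0 (2 * PI) I ->
  (forall th, Rabs (h th - k th) <= eps) ->
  Rabs (1 / PI * RInt h 0 (2 * PI) - 1 / PI * I) <= 2 * eps.
Proof.
  intros Hh Hk He. pose proof PI_RGT_0 as Hpi.
  assert (Ih : ex_RInt h 0 (2 * PI)) by (apply (ex_RInt_continuous (V := R_CompleteNormedModule)); auto).
  rewrite <- (is_RInt_unique k _ _ _ Hk).
  replace (1 / PI * RInt h 0 (2 * PI) - 1 / PI * RInt k 0 (2 * PI)) with
    (1 / PI * RInt (fun th => h th - k th) 0 (2 * PI)).
  - rewrite Rabs_mult, (Rabs_right (1 / PI))
      by (apply Rle_ge, Rlt_le, Rdiv_lt_0_compat; lra).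
    replace (2 * eps) with (1 / PI * ((2 * PI - 0) * eps)) by (field; lra).
    apply Rmult_le_compat_l; [ apply Rlt_le, Rdiv_lt_0_compat; lra | ].
    apply abs_RInt_le_const; [ lra | | auto ].
    apply (ex_RInt_minus (V := R_NormedModule)); trivial. now exists I.
  - pose proof (RInt_minus (V := R_CompleteNormedModule) h k 0 (2 * PI) Ih
      (ex_intro _ I Hk)) as E.
    unfold minus, plus, opp in E; simpl in E. unfold Rminus at 1; rewrite E. ring.
Qed.

Definition on_circle (F : point -> R) (x y t sigma th : R) : R :=
  F (x + cos th * sigma, y + sin th * sigma, t).

(** Second order Taylor polynomial in space at (x, y, t), evaluated at the displacement (sigma a,
    sigma b). *)
Definition quadratic (F : point -> R) (x y t sigma a b : R) : R :=
  F (x, y, t) + sigma * (a * ddx F (x, y, t) + b * ddy F (x, y, t))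
  + sigma ^ 2 / 2 * (a ^ 2 * ddx (ddx F) (x, y, t)
      + 2 * a * b * ddx (ddy F) (x, y, t) + b ^ 2 * ddy (ddy F) (x, y, t)).

Lemma Rabs_cos_le1 th : Rabs (cos th) <= 1.
Proof. apply Rabs_le, COS_bound. Qed.

Lemma Rabs_sin_le1 th : Rabs (sin th) <= 1.
Proof. apply Rabs_le, SIN_bound. Qed.

Lemma circle_taylor T F x y t c : smooth 3 T F -> t < T -> 0 < c ->
  exists r C, 0 < r /\ forall x' y' tau th, near r x y x' y' -> 0 < tau < r ->
    Rabs (on_circle F x' y' t (c * tau) th
          - quadratic F x' y' t (c * tau) (cos th) (sin th)) <= C * tau ^ 3.
Proof.
  intros SF Ht Hc.
  destruct (spatial_taylor T F x y t SF Ht) as (r & C & Hr & H).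
  (* The displacement is [c * tau]: it has to stay below [r], and its cube brings the factor
     [c ^ 3]. *)
  exists (Rmin r (r / c)), (C * c ^ 3).
  split; [ apply Rmin_glb_lt; trivial; now apply Rdiv_lt_0_compat | ].
  intros x' y' tau th Hn Htau.
  replace (C * c ^ 3 * tau ^ 3) with (C * (c * tau) ^ 3) by ring.
  apply H.
  - apply near_weaken with (2 := Hn), Rmin_l.
  - split; [ nra | ]. replace r with (c * (r / c)) by (field; lra).
    apply Rmult_lt_compat_l; trivial.
    apply Rlt_le_trans with (1 := proj2 Htau), Rmin_r.
  - apply Rabs_cos_le1.
  - apply Rabs_sin_le1.
Qed.

Lemma continuous_on_circle T F x y t sigma th : smooth 0 T F -> t < T ->
  continuous (on_circle F x y t sigma) th.
Proof.
  intros [HF _] Ht.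
  apply (continuous_along F (fun th => x + cos th * sigma) (fun th => y + sin th * sigma)
           (fun _ => t)).
  - apply (ex_derive_continuous (V := R_NormedModule)); now auto_derive.
  - apply (ex_derive_continuous (V := R_NormedModule)); now auto_derive.
  - apply continuous_const.
  - now apply HF.
Qed.

Lemma ddx_scal a F X : ddx (fun Y => a * F Y) X = a * ddx F X.
Proof. apply Derive_scal. Qed.

Lemma ddy_scal a F X : ddy (fun Y => a * F Y) X = a * ddy F X.
Proof. apply Derive_scal. Qed.

Lemma ddx_lincomb T a b F G x y t : smooth 1 T F -> smooth 1 T G -> t < T ->
  ddx (fun Y => a * F Y + b * G Y) (x, y, t) = a * ddx F (x, y, t) + b * ddx G (x, y, t).
Proof.
  intros HF HG Ht. apply is_derive_unique.
  apply (is_derive_lincomb a b (fun s => F (s, y, t)) (fun s => G (s, y, t))).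
  - exact (smooth_is_derive_x _ _ _ x y t HF Ht).
  - exact (smooth_is_derive_x _ _ _ x y t HG Ht).
Qed.

Lemma ddy_lincomb T a b F G x y t : smooth 1 T F -> smooth 1 T G -> t < T ->
  ddy (fun Y => a * F Y + b * G Y) (x, y, t) = a * ddy F (x, y, t) + b * ddy G (x, y, t).
Proof.
  intros HF HG Ht. apply is_derive_unique.
  apply (is_derive_lincomb a b (fun s => F (x, s, t)) (fun s => G (x, s, t))).
  - exact (smooth_is_derive_y _ _ _ x y t HF Ht).
  - exact (smooth_is_derive_y _ _ _ x y t HG Ht).
Qed.

Lemma smooth_scal k T a F : smooth k T F -> smooth k T (fun X => a * F X).
Proof.
  intros HF. apply smooth_ext with (fun X => a * F X + 0 * F X).
  - intros; ring.
  - now apply smooth_lincomb.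
Qed.

(* The momentum and pressure equations in the frame moving with (u', v'), where the
   advection terms disappear. *)
Definition acoustic (T r0 c : R) (p u v : point -> R) : Prop :=
  forall x y t, 0 < t < T ->
    is_derive (fun s => p (x, y, s)) t
      (- (r0 * c ^ 2) * ddx u (x, y, t) + - (r0 * c ^ 2) * ddy v (x, y, t)) /\
    is_derive (fun s => u (x, y, s)) t (- / r0 * ddx p (x, y, t)) /\
    is_derive (fun s => v (x, y, s)) t (- / r0 * ddy p (x, y, t)).

Lemma pressure_time_taylor T r0 c p u v x y t : acoustic T r0 c p u v -> 0 < r0 ->
  smooth 3 T p -> smooth 3 T u -> smooth 3 T v -> 0 <= t < T ->
  exists r C, 0 < r /\ forall x' y' tau, near r x y x' y' -> 0 < tau < r ->
    Rabs (p (x', y', t + tau) - (p (x', y', t)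
        + tau * (- (r0 * c ^ 2) * ddx u (x', y', t) + - (r0 * c ^ 2) * ddy v (x', y', t))
        + tau ^ 2 / 2 * (c ^ 2 * ddx (ddx p) (x', y', t) + c ^ 2 * ddy (ddy p) (x', y', t))))
      <= C * tau ^ 3.
Proof.
  intros HA Hr0 Sp Su Sv Ht.
  assert (Spx := smooth_ddx _ _ _ Sp). assert (Spy := smooth_ddy _ _ _ Sp).
  refine (time_taylor T p (fun X => - (r0 * c ^ 2) * ddx u X + - (r0 * c ^ 2) * ddy v X)
    (fun X => c ^ 2 * ddx (ddx p) X + c ^ 2 * ddy (ddy p) X) x y t _ _ _ _ _ Ht).
  - now do 3 apply smooth_pred.
  - do 2 apply smooth_pred.
    apply smooth_lincomb; [ now apply smooth_ddx | now apply smooth_ddy ].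
  - apply smooth_lincomb; [ now apply smooth_ddx | now apply smooth_ddy ].
  - intros; now apply HA.
  - intros x1 y1 t1 Ht1.
    (* The Laplacian is rewritten as the divergence of (u_t, v_t), the form to which the exchange of
       time and space derivatives applies. *)
    replace (c ^ 2 * ddx (ddx p) (x1, y1, t1) + c ^ 2 * ddy (ddy p) (x1, y1, t1)) with
      (- (r0 * c ^ 2) * ddx (fun X => - / r0 * ddx p X) (x1, y1, t1)
       + - (r0 * c ^ 2) * ddy (fun X => - / r0 * ddy p X) (x1, y1, t1))
      by (rewrite ddx_scal, ddy_scal; field; lra).
    apply is_derive_lincomb.
    + apply is_derive_t_ddx with T; trivial; [ now apply smooth_pred | intros; now apply HA | ].
      apply smooth_scal; now apply smooth_pred.
    + apply is_derive_t_ddy with T; trivial; [ now apply smooth_pred | intros; now apply HA | ].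
      apply smooth_scal; now apply smooth_pred.
Qed.

Lemma velocity_x_time_taylor T r0 c p u v x y t : acoustic T r0 c p u v -> 0 < r0 ->
  smooth 3 T p -> smooth 3 T u -> smooth 3 T v -> 0 <= t < T ->
  exists r C, 0 < r /\ forall x' y' tau, near r x y x' y' -> 0 < tau < r ->
    Rabs (u (x', y', t + tau) - (u (x', y', t)
        + tau * (- / r0 * ddx p (x', y', t))
        + tau ^ 2 / 2 * (c ^ 2 * ddx (ddx u) (x', y', t) + c ^ 2 * ddx (ddy v) (x', y', t))))
      <= C * tau ^ 3.
Proof.
  intros HA Hr0 Sp Su Sv Ht.
  assert (Sux := smooth_ddx _ _ _ Su). assert (Svy := smooth_ddy _ _ _ Sv).
  refine (time_taylor T u (fun X => - / r0 * ddx p X)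
    (fun X => c ^ 2 * ddx (ddx u) X + c ^ 2 * ddx (ddy v) X) x y t _ _ _ _ _ Ht).
  - now do 3 apply smooth_pred.
  - do 2 apply smooth_pred. apply smooth_scal; now apply smooth_ddx.
  - apply smooth_lincomb; now apply smooth_ddx.
  - intros; now apply HA.
  - intros x1 y1 t1 Ht1.
    replace (c ^ 2 * ddx (ddx u) (x1, y1, t1) + c ^ 2 * ddx (ddy v) (x1, y1, t1)) with
      (- / r0 * ddx (fun X => - (r0 * c ^ 2) * ddx u X + - (r0 * c ^ 2) * ddy v X)
                  (x1, y1, t1)).
    + apply is_derive_scal. apply is_derive_t_ddx with T; trivial;
        [ now apply smooth_pred | intros; now apply HA | ].
      apply smooth_lincomb; now apply smooth_pred.
    + rewrite (ddx_lincomb T); try now apply smooth_pred.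
      * field; lra.
      * lra.
Qed.

Lemma velocity_y_time_taylor T r0 c p u v x y t : acoustic T r0 c p u v -> 0 < r0 ->
  smooth 3 T p -> smooth 3 T u -> smooth 3 T v -> 0 <= t < T ->
  exists r C, 0 < r /\ forall x' y' tau, near r x y x' y' -> 0 < tau < r ->
    Rabs (v (x', y', t + tau) - (v (x', y', t)
        + tau * (- / r0 * ddy p (x', y', t))
        + tau ^ 2 / 2 * (c ^ 2 * ddx (ddy u) (x', y', t) + c ^ 2 * ddy (ddy v) (x', y', t))))
      <= C * tau ^ 3.
Proof.
  intros HA Hr0 Sp Su Sv Ht.
  assert (Sux := smooth_ddx _ _ _ Su). assert (Svy := smooth_ddy _ _ _ Sv).
  refine (time_taylor T v (fun X => - / r0 * ddy p X)
    (fun X => c ^ 2 * ddx (ddy u) X + c ^ 2 * ddy (ddy v) X) x y t _ _ _ _ _ Ht).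
  - now do 3 apply smooth_pred.
  - do 2 apply smooth_pred. apply smooth_scal; now apply smooth_ddy.
  - apply smooth_lincomb; [ now apply smooth_ddx, smooth_ddy | now apply smooth_ddy ].
  - intros; now apply HA.
  - intros x1 y1 t1 Ht1.
    replace (c ^ 2 * ddx (ddy u) (x1, y1, t1) + c ^ 2 * ddy (ddy v) (x1, y1, t1)) with
      (- / r0 * ddy (fun X => - (r0 * c ^ 2) * ddx u X + - (r0 * c ^ 2) * ddy v X)
                  (x1, y1, t1)).
    + apply is_derive_scal. apply is_derive_t_ddy with T; trivial;
        [ now apply smooth_pred | intros; now apply HA | ].
      apply smooth_lincomb; now apply smooth_pred.
    (* Here the divergence is differentiated in y, so its first term has the derivatives in the
       order opposite to the one in the statement. *)
    + rewrite (ddy_lincomb T), (ddy_ddx T); try now apply smooth_pred.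
      * field; lra.
      * lra.
      * lra.
Qed.

Lemma Rabs_minus_le z w a b : Rabs z <= a -> Rabs w <= b -> Rabs (z - w) <= a + b.
Proof. intros H1 H2. apply Rabs_le_between in H1, H2. apply Rabs_le; lra. Qed.

Lemma Rabs_plus_le z w a b : Rabs z <= a -> Rabs w <= b -> Rabs (z + w) <= a + b.
Proof. intros H1 H2. apply Rabs_le_between in H1, H2. apply Rabs_le; lra. Qed.

Lemma Rabs_scal_le k z b : 0 <= k -> Rabs z <= b -> Rabs (k * z) <= k * b.
Proof.
  intros Hk Hz. rewrite Rabs_mult, (Rabs_right k) by lra.
  now apply Rmult_le_compat_l.
Qed.

Lemma Rabs_weight_le w z K b : Rabs w <= K -> Rabs z <= b -> Rabs (w * z) <= K * b.
Proof. intros Hw Hz. rewrite Rabs_mult. apply Rmult_le_compat; trivial; apply Rabs_pos. Qed.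

(** With [sigma = c * tau] the second order part, once divided by pi, is exactly
    [tau ^ 2 / 2 * p_tt]. *)
Lemma is_RInt_pressure_quadratic p x y t sigma :
  is_RInt (fun th => quadratic p x y t sigma (cos th) (sin th)) 0 (2 * PI)
    (PI * (2 * p (x, y, t)
       + sigma ^ 2 / 2 * (ddx (ddx p) (x, y, t) + ddy (ddy p) (x, y, t)))).
Proof.
  set (h := sigma ^ 2 / 2).
  replace (PI * _) with
    (2 * PI * (p (x, y, t) + h * ddy (ddy p) (x, y, t))
     + PI * (h * (ddx (ddx p) (x, y, t) - ddy (ddy p) (x, y, t)))
     + 3 * PI / 4 * 0) by field.
  eapply is_RInt_ext; [ | apply (is_RInt_trig_poly
    (p (x, y, t) + h * ddy (ddy p) (x, y, t)) (sigma * ddx p (x, y, t))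
    (sigma * ddy p (x, y, t)) (h * (ddx (ddx p) (x, y, t) - ddy (ddy p) (x, y, t)))
    (2 * h * ddx (ddy p) (x, y, t)) 0 0 0 0) ].
  intros th _. unfold quadratic; fold h. simpl. ring [(sin_sqr th)].
Qed.

(** The weights are 1/2 + cos 2 th and sin 2 th. Of the second order part of [u], the constant 1/2
    extracts (u_xx + u_yy)/2 and cos 2 th extracts (u_xx - u_yy)/2, with sum u_xx; sin 2 th extracts
    v_xy from [v]. This is the right side of the equation for u_tt. *)
Lemma is_RInt_velocity_x_quadratic u v x y t sigma :
  is_RInt (fun th => quadratic u x y t sigma (cos th) (sin th) * (2 * cos th ^ 2 - 1 / 2)
      + 2 * quadratic v x y t sigma (cos th) (sin th) * sin th * cos th) 0 (2 * PI)
    (PI * (u (x, y, t)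
       + sigma ^ 2 / 2 * (ddx (ddx u) (x, y, t) + ddx (ddy v) (x, y, t)))).
Proof.
  (* Naming the two quotients leaves a polynomial identity in atoms for the final [ring]. *)
  set (h := sigma ^ 2 / 2). set (o := 1 / 2).
  set (u0 := u (x, y, t)). set (ux := ddx u (x, y, t)). set (uy := ddy u (x, y, t)).
  set (uxx := ddx (ddx u) (x, y, t)). set (uxy := ddx (ddy u) (x, y, t)).
  set (uyy := ddy (ddy u) (x, y, t)).
  set (v0 := v (x, y, t)). set (vx := ddx v (x, y, t)). set (vy := ddy v (x, y, t)).
  set (vxx := ddx (ddx v) (x, y, t)). set (vxy := ddx (ddy v) (x, y, t)).
  set (vyy := ddy (ddy v) (x, y, t)).
  replace (PI * (u0 + h * (uxx + vxy))) with
    (2 * PI * (- o * (u0 + h * uyy))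
     + PI * (2 * (u0 + h * uyy) - o * h * (uxx - uyy) + 4 * h * vxy)
     + 3 * PI / 4 * (2 * h * (uxx - uyy) - 4 * h * vxy)) by (unfold o; field).
  eapply is_RInt_ext; [ | apply (is_RInt_trig_poly
    (- o * (u0 + h * uyy))
    (- o * sigma * ux + 2 * sigma * vy)
    (- o * sigma * uy)
    (2 * (u0 + h * uyy) - o * h * (uxx - uyy) + 4 * h * vxy)
    (- o * h * 2 * uxy + 2 * (v0 + h * vyy))
    (2 * sigma * ux - 2 * sigma * vy)
    (2 * sigma * uy + 2 * sigma * vx)
    (2 * h * (uxx - uyy) - 4 * h * vxy)
    (4 * h * uxy + 2 * h * (vxx - vyy))) ].
  intros th _. unfold quadratic. fold h o u0 ux uy uxx uxy uyy v0 vx vy vxx vxy vyy.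
  simpl. ring [(sin_sqr th)].
Qed.

Lemma is_RInt_velocity_y_quadratic u v x y t sigma :
  is_RInt (fun th => quadratic v x y t sigma (cos th) (sin th) * (2 * sin th ^ 2 - 1 / 2)
      + 2 * quadratic u x y t sigma (cos th) (sin th) * sin th * cos th) 0 (2 * PI)
    (PI * (v (x, y, t)
       + sigma ^ 2 / 2 * (ddx (ddy u) (x, y, t) + ddy (ddy v) (x, y, t)))).
Proof.
  (* In terms of the cosine the weight [2 * sin th ^ 2 - 1 / 2] is [w - 2 * cos th ^ 2]. *)
  set (h := sigma ^ 2 / 2). set (o := 1 / 2). set (w := 2 - o).
  set (u0 := u (x, y, t)). set (ux := ddx u (x, y, t)). set (uy := ddy u (x, y, t)).
  set (uxx := ddx (ddx u) (x, y, t)). set (uxy := ddx (ddy u) (x, y, t)).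
  set (uyy := ddy (ddy u) (x, y, t)).
  set (v0 := v (x, y, t)). set (vx := ddx v (x, y, t)). set (vy := ddy v (x, y, t)).
  set (vxx := ddx (ddx v) (x, y, t)). set (vxy := ddx (ddy v) (x, y, t)).
  set (vyy := ddy (ddy v) (x, y, t)).
  replace (PI * (v0 + h * (uxy + vyy))) with
    (2 * PI * (w * (v0 + h * vyy))
     + PI * (w * h * (vxx - vyy) - 2 * (v0 + h * vyy) + 4 * h * uxy)
     + 3 * PI / 4 * (- 2 * h * (vxx - vyy) - 4 * h * uxy)) by (unfold w, o; field).
  eapply is_RInt_ext; [ | apply (is_RInt_trig_poly
    (w * (v0 + h * vyy))
    (w * sigma * vx + 2 * sigma * uy)
    (w * sigma * vy)
    (w * h * (vxx - vyy) - 2 * (v0 + h * vyy) + 4 * h * uxy)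
    (2 * h * w * vxy + 2 * (u0 + h * uyy))
    (- 2 * sigma * vx - 2 * sigma * uy)
    (- 2 * sigma * vy + 2 * sigma * ux)
    (- 2 * h * (vxx - vyy) - 4 * h * uxy)
    (- 4 * h * vxy + 2 * h * (uxx - uyy))) ].
  intros th _. unfold quadratic. fold h o u0 ux uy uxx uxy uyy v0 vx vy vxx vxy vyy.
  unfold w. simpl. ring [(sin_sqr th)].
Qed.

(** Even orders agree at opposite points, so no second order term survives and the difference is a
    centred quotient for the first derivative. *)
Lemma quadratic_odd_x F x y t sigma :
  quadratic F x y t sigma (cos 0) (sin 0) - quadratic F x y t sigma (cos PI) (sin PI)
  = 2 * sigma * ddx F (x, y, t).
Proof. unfold quadratic. rewrite cos_0, sin_0, cos_PI, sin_PI. field. Qed.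

Lemma quadratic_odd_y F x y t sigma :
  quadratic F x y t sigma (cos (PI / 2)) (sin (PI / 2))
  - quadratic F x y t sigma (cos (3 * PI / 2)) (sin (3 * PI / 2))
  = 2 * sigma * ddy F (x, y, t).
Proof.
  replace (3 * PI / 2) with (3 * (PI / 2)) by field.
  unfold quadratic. rewrite cos_PI2, sin_PI2, cos_3PI2, sin_3PI2. field.
Qed.

Lemma pressure_evolution T r0 c p u v x y t : acoustic T r0 c p u v -> 0 < r0 -> 0 < c ->
  smooth 3 T p -> smooth 3 T u -> smooth 3 T v -> 0 <= t < T ->
  exists r C, 0 < r /\ forall x' y' tau, near r x y x' y' -> 0 < tau < r ->
    Rabs (p (x', y', t + tau) -
      (- p (x', y', t)
       + 1 / PI * RInt (on_circle p x' y' t (c * tau)) 0 (2 * PI)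
       - r0 * c / 2 * (on_circle u x' y' t (c * tau) 0 - on_circle u x' y' t (c * tau) PI)
       - r0 * c / 2 * (on_circle v x' y' t (c * tau) (PI / 2)
                       - on_circle v x' y' t (c * tau) (3 * PI / 2)))) <= C * tau ^ 3.
Proof.
  intros HA Hr0 Hc Sp Su Sv Ht. pose proof PI_RGT_0 as Hpi.
  destruct (pressure_time_taylor T r0 c p u v x y t HA Hr0 Sp Su Sv Ht)
    as (r1 & C1 & R1 & H1).
  destruct (circle_taylor T p x y t c Sp (proj2 Ht) Hc) as (r2 & C2 & R2 & H2).
  destruct (circle_taylor T u x y t c Su (proj2 Ht) Hc) as (r3 & C3 & R3 & H3).
  destruct (circle_taylor T v x y t c Sv (proj2 Ht) Hc) as (r4 & C4 & R4 & H4).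
  exists (Rmin (Rmin r1 r2) (Rmin r3 r4)),
    (C1 + 2 * C2 + r0 * c / 2 * (C3 + C3) + r0 * c / 2 * (C4 + C4)).
  split; [ now repeat apply Rmin_glb_lt | ].
  intros x' y' tau [Nx Ny] [Htau Hr].
  apply Rmin_Rgt in Hr as [[T1 T2]%Rmin_Rgt [T3 T4]%Rmin_Rgt].
  apply Rmin_Rgt in Nx as [[X1 X2]%Rmin_Rgt [X3 X4]%Rmin_Rgt].
  apply Rmin_Rgt in Ny as [[Y1 Y2]%Rmin_Rgt [Y3 Y4]%Rmin_Rgt].
  specialize (H1 x' y' tau (conj X1 Y1) (conj Htau T1)).
  assert (H2' := fun th => H2 x' y' tau th (conj X2 Y2) (conj Htau T2)).
  assert (H3' := fun th => H3 x' y' tau th (conj X3 Y3) (conj Htau T3)).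
  assert (H4' := fun th => H4 x' y' tau th (conj X4 Y4) (conj Htau T4)).
  assert (HI := circle_mean_bound _ _ _ _
    (fun th => continuous_on_circle T p x' y' t (c * tau) th
                 (smooth_pred _ _ _ (smooth_pred _ _ _ (smooth_pred _ _ _ Sp))) (proj2 Ht))
    (is_RInt_pressure_quadratic p x' y' t (c * tau)) H2').
  assert (HK : 0 <= r0 * c / 2) by nra.
  assert (B3 := Rabs_scal_le _ _ _ HK (Rabs_minus_le _ _ _ _ (H3' 0) (H3' PI))).
  assert (B4 := Rabs_scal_le _ _ _ HK
    (Rabs_minus_le _ _ _ _ (H4' (PI / 2)) (H4' (3 * PI / 2)))).
  assert (B := Rabs_plus_le _ _ _ _ (Rabs_plus_le _ _ _ _
    (Rabs_minus_le _ _ _ _ H1 HI) B3) B4).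
  assert (Ou := quadratic_odd_x u x' y' t (c * tau)).
  assert (Ov := quadratic_odd_y v x' y' t (c * tau)).
  (* [B] bounds a sum of remainders. Its content equals the error to be bounded because the Taylor
     polynomials cancel: the second order terms against each other, and [2 * c * tau] times the
     first derivatives, weighted by [r0 * c / 2], against the first order term of [p]. *)
  match type of B with Rabs ?z <= ?w =>
    match goal with |- Rabs ?z' <= ?w' => replace z' with z; [ replace w' with w by ring; exact B | ]
    end end.
  set (qu0 := quadratic u _ _ _ _ _ (sin 0)) in *.
  set (qv0 := quadratic v _ _ _ _ _ (sin (PI / 2))) in *.
  replace qu0 with (2 * (c * tau) * ddx u (x', y', t)
    + quadratic u x' y' t (c * tau) (cos PI) (sin PI)) by (rewrite <- Ou; ring).
  replace qv0 with (2 * (c * tau) * ddy v (x', y', t)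
    + quadratic v x' y' t (c * tau) (cos (3 * PI / 2)) (sin (3 * PI / 2)))
    by (rewrite <- Ov; ring).
  field; lra.
Qed.

Lemma velocity_x_evolution T r0 c p u v x y t :
  acoustic T r0 c p u v -> 0 < r0 -> 0 < c ->
  smooth 3 T p -> smooth 3 T u -> smooth 3 T v -> 0 <= t < T ->
  exists r C, 0 < r /\ forall x' y' tau, near r x y x' y' -> 0 < tau < r ->
    Rabs (u (x', y', t + tau) -
      (1 / PI * RInt (fun th : R =>
           on_circle u x' y' t (c * tau) th * (2 * cos th ^ 2 - 1 / 2)
           + 2 * on_circle v x' y' t (c * tau) th * sin th * cos th) 0 (2 * PI)
       - 1 / (2 * r0 * c) * (on_circle p x' y' t (c * tau) 0
                             - on_circle p x' y' t (c * tau) PI))) <= C * tau ^ 3.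
Proof.
  intros HA Hr0 Hc Sp Su Sv Ht. pose proof PI_RGT_0 as Hpi.
  destruct (velocity_x_time_taylor T r0 c p u v x y t HA Hr0 Sp Su Sv Ht)
    as (r1 & C1 & R1 & H1).
  destruct (circle_taylor T p x y t c Sp (proj2 Ht) Hc) as (r2 & C2 & R2 & H2).
  destruct (circle_taylor T u x y t c Su (proj2 Ht) Hc) as (r3 & C3 & R3 & H3).
  destruct (circle_taylor T v x y t c Sv (proj2 Ht) Hc) as (r4 & C4 & R4 & H4).
  exists (Rmin (Rmin r1 r2) (Rmin r3 r4)),
    (C1 + 2 * (3 / 2 * C3 + 2 * C4) + 1 / (2 * r0 * c) * (C2 + C2)).
  split; [ now repeat apply Rmin_glb_lt | ].
  intros x' y' tau [Nx Ny] [Htau Hr].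
  apply Rmin_Rgt in Hr as [[T1 T2]%Rmin_Rgt [T3 T4]%Rmin_Rgt].
  apply Rmin_Rgt in Nx as [[X1 X2]%Rmin_Rgt [X3 X4]%Rmin_Rgt].
  apply Rmin_Rgt in Ny as [[Y1 Y2]%Rmin_Rgt [Y3 Y4]%Rmin_Rgt].
  specialize (H1 x' y' tau (conj X1 Y1) (conj Htau T1)).
  assert (H2' := fun th => H2 x' y' tau th (conj X2 Y2) (conj Htau T2)).
  assert (H3' := fun th => H3 x' y' tau th (conj X3 Y3) (conj Htau T3)).
  assert (H4' := fun th => H4 x' y' tau th (conj X4 Y4) (conj Htau T4)).
  assert (HI : forall th, Rabs (
      (on_circle u x' y' t (c * tau) th * (2 * cos th ^ 2 - 1 / 2)
       + 2 * on_circle v x' y' t (c * tau) th * sin th * cos th)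
      - (quadratic u x' y' t (c * tau) (cos th) (sin th) * (2 * cos th ^ 2 - 1 / 2)
         + 2 * quadratic v x' y' t (c * tau) (cos th) (sin th) * sin th * cos th))
      <= 3 / 2 * (C3 * tau ^ 3) + 2 * (C4 * tau ^ 3)).
  { intros th.
    (* This weight ranges over [-1/2, 3/2]; for the other one the crude bound 2 is enough. *)
    assert (W1 : Rabs (2 * cos th ^ 2 - 1 / 2) <= 3 / 2).
    { generalize (Rabs_cos_le1 th); intros [L1 L2]%Rabs_le_between.
      apply Rabs_le; nra. }
    assert (W2 : Rabs (2 * sin th * cos th) <= 2).
    { generalize (Rabs_sin_le1 th) (Rabs_cos_le1 th) (Rabs_pos (sin th)) (Rabs_pos (cos th)).
      rewrite !Rabs_mult, (Rabs_right 2) by lra. nra. }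
    eapply Rle_trans; [ | exact (Rabs_plus_le _ _ _ _
      (Rabs_weight_le _ _ _ _ W1 (H3' th)) (Rabs_weight_le _ _ _ _ W2 (H4' th))) ].
    right; f_equal; ring. }
  assert (S0 : smooth 0 T u) by now do 3 apply smooth_pred.
  assert (S0' : smooth 0 T v) by now do 3 apply smooth_pred.
  assert (HC : forall th, continuous (fun th : R =>
       on_circle u x' y' t (c * tau) th * (2 * cos th ^ 2 - 1 / 2)
       + 2 * on_circle v x' y' t (c * tau) th * sin th * cos th) th).
  { intros th.
    apply (continuous_ext (fun th =>
       (2 * cos th ^ 2 - 1 / 2) * on_circle u x' y' t (c * tau) th
       + (2 * sin th * cos th) * on_circle v x' y' t (c * tau) th)); [ intros; simpl; ring | ].
    apply (continuous_plus (V := R_NormedModule)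
      (fun th => (2 * cos th ^ 2 - 1 / 2) * on_circle u x' y' t (c * tau) th)
      (fun th => (2 * sin th * cos th) * on_circle v x' y' t (c * tau) th)).
    - apply (continuous_mult (K := R_AbsRing) (fun th => 2 * cos th ^ 2 - 1 / 2)
        (on_circle u x' y' t (c * tau))).
      + apply (ex_derive_continuous (V := R_NormedModule)); now auto_derive.
      + now apply continuous_on_circle with (2 := proj2 Ht).
    - apply (continuous_mult (K := R_AbsRing) (fun th => 2 * sin th * cos th)
        (on_circle v x' y' t (c * tau))).
      + apply (ex_derive_continuous (V := R_NormedModule)); now auto_derive.
      + now apply continuous_on_circle with (2 := proj2 Ht). }
  assert (HM := circle_mean_bound _ _ _ _ HC
    (is_RInt_velocity_x_quadratic u v x' y' t (c * tau)) HI).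
  assert (HK : 0 <= 1 / (2 * r0 * c)) by (apply Rlt_le, Rdiv_lt_0_compat; nra).
  assert (B2 := Rabs_scal_le _ _ _ HK (Rabs_minus_le _ _ _ _ (H2' 0) (H2' PI))).
  assert (B := Rabs_plus_le _ _ _ _ (Rabs_minus_le _ _ _ _ H1 HM) B2).
  assert (Op := quadratic_odd_x p x' y' t (c * tau)).
  match type of B with Rabs ?z <= ?w =>
    match goal with |- Rabs ?z' <= ?w' =>
      replace z' with z; [ replace w' with w by (field; lra); exact B | ]
    end end.
  set (qp0 := quadratic p _ _ _ _ _ (sin 0)) in *.
  replace qp0 with (2 * (c * tau) * ddx p (x', y', t)
    + quadratic p x' y' t (c * tau) (cos PI) (sin PI)) by (rewrite <- Op; ring).
  field; lra.
Qed.

Lemma velocity_y_evolution T r0 c p u v x y t :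
  acoustic T r0 c p u v -> 0 < r0 -> 0 < c ->
  smooth 3 T p -> smooth 3 T u -> smooth 3 T v -> 0 <= t < T ->
  exists r C, 0 < r /\ forall x' y' tau, near r x y x' y' -> 0 < tau < r ->
    Rabs (v (x', y', t + tau) -
      (1 / PI * RInt (fun th : R =>
           on_circle v x' y' t (c * tau) th * (2 * sin th ^ 2 - 1 / 2)
           + 2 * on_circle u x' y' t (c * tau) th * sin th * cos th) 0 (2 * PI)
       - 1 / (2 * r0 * c) * (on_circle p x' y' t (c * tau) (PI / 2)
                             - on_circle p x' y' t (c * tau) (3 * PI / 2)))) <= C * tau ^ 3.
Proof.
  intros HA Hr0 Hc Sp Su Sv Ht. pose proof PI_RGT_0 as Hpi.
  destruct (velocity_y_time_taylor T r0 c p u v x y t HA Hr0 Sp Su Sv Ht)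
    as (r1 & C1 & R1 & H1).
  destruct (circle_taylor T p x y t c Sp (proj2 Ht) Hc) as (r2 & C2 & R2 & H2).
  destruct (circle_taylor T v x y t c Sv (proj2 Ht) Hc) as (r3 & C3 & R3 & H3).
  destruct (circle_taylor T u x y t c Su (proj2 Ht) Hc) as (r4 & C4 & R4 & H4).
  exists (Rmin (Rmin r1 r2) (Rmin r3 r4)),
    (C1 + 2 * (3 / 2 * C3 + 2 * C4) + 1 / (2 * r0 * c) * (C2 + C2)).
  split; [ now repeat apply Rmin_glb_lt | ].
  intros x' y' tau [Nx Ny] [Htau Hr].
  apply Rmin_Rgt in Hr as [[T1 T2]%Rmin_Rgt [T3 T4]%Rmin_Rgt].
  apply Rmin_Rgt in Nx as [[X1 X2]%Rmin_Rgt [X3 X4]%Rmin_Rgt].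
  apply Rmin_Rgt in Ny as [[Y1 Y2]%Rmin_Rgt [Y3 Y4]%Rmin_Rgt].
  specialize (H1 x' y' tau (conj X1 Y1) (conj Htau T1)).
  assert (H2' := fun th => H2 x' y' tau th (conj X2 Y2) (conj Htau T2)).
  assert (H3' := fun th => H3 x' y' tau th (conj X3 Y3) (conj Htau T3)).
  assert (H4' := fun th => H4 x' y' tau th (conj X4 Y4) (conj Htau T4)).
  assert (HI : forall th, Rabs (
      (on_circle v x' y' t (c * tau) th * (2 * sin th ^ 2 - 1 / 2)
       + 2 * on_circle u x' y' t (c * tau) th * sin th * cos th)
      - (quadratic v x' y' t (c * tau) (cos th) (sin th) * (2 * sin th ^ 2 - 1 / 2)
         + 2 * quadratic u x' y' t (c * tau) (cos th) (sin th) * sin th * cos th))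
      <= 3 / 2 * (C3 * tau ^ 3) + 2 * (C4 * tau ^ 3)).
  { intros th.
    assert (W1 : Rabs (2 * sin th ^ 2 - 1 / 2) <= 3 / 2).
    { generalize (Rabs_sin_le1 th); intros [L1 L2]%Rabs_le_between.
      apply Rabs_le; nra. }
    assert (W2 : Rabs (2 * sin th * cos th) <= 2).
    { generalize (Rabs_sin_le1 th) (Rabs_cos_le1 th) (Rabs_pos (sin th)) (Rabs_pos (cos th)).
      rewrite !Rabs_mult, (Rabs_right 2) by lra. nra. }
    eapply Rle_trans; [ | exact (Rabs_plus_le _ _ _ _
      (Rabs_weight_le _ _ _ _ W1 (H3' th)) (Rabs_weight_le _ _ _ _ W2 (H4' th))) ].
    right; f_equal; ring. }
  assert (S0 : smooth 0 T v) by now do 3 apply smooth_pred.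
  assert (S0' : smooth 0 T u) by now do 3 apply smooth_pred.
  assert (HC : forall th, continuous (fun th : R =>
       on_circle v x' y' t (c * tau) th * (2 * sin th ^ 2 - 1 / 2)
       + 2 * on_circle u x' y' t (c * tau) th * sin th * cos th) th).
  { intros th.
    apply (continuous_ext (fun th =>
       (2 * sin th ^ 2 - 1 / 2) * on_circle v x' y' t (c * tau) th
       + (2 * sin th * cos th) * on_circle u x' y' t (c * tau) th)); [ intros; simpl; ring | ].
    apply (continuous_plus (V := R_NormedModule)
      (fun th => (2 * sin th ^ 2 - 1 / 2) * on_circle v x' y' t (c * tau) th)
      (fun th => (2 * sin th * cos th) * on_circle u x' y' t (c * tau) th)).
    - apply (continuous_mult (K := R_AbsRing) (fun th => 2 * sin th ^ 2 - 1 / 2)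
        (on_circle v x' y' t (c * tau))).
      + apply (ex_derive_continuous (V := R_NormedModule)); now auto_derive.
      + now apply continuous_on_circle with (2 := proj2 Ht).
    - apply (continuous_mult (K := R_AbsRing) (fun th => 2 * sin th * cos th)
        (on_circle u x' y' t (c * tau))).
      + apply (ex_derive_continuous (V := R_NormedModule)); now auto_derive.
      + now apply continuous_on_circle with (2 := proj2 Ht). }
  assert (HM := circle_mean_bound _ _ _ _ HC
    (is_RInt_velocity_y_quadratic u v x' y' t (c * tau)) HI).
  assert (HK : 0 <= 1 / (2 * r0 * c)) by (apply Rlt_le, Rdiv_lt_0_compat; nra).
  assert (B2 := Rabs_scal_le _ _ _ HK (Rabs_minus_le _ _ _ _ (H2' (PI / 2)) (H2' (3 * PI / 2)))).
  assert (B := Rabs_plus_le _ _ _ _ (Rabs_minus_le _ _ _ _ H1 HM) B2).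
  assert (Op := quadratic_odd_y p x' y' t (c * tau)).
  match type of B with Rabs ?z <= ?w =>
    match goal with |- Rabs ?z' <= ?w' =>
      replace z' with z; [ replace w' with w by (field; lra); exact B | ]
    end end.
  set (qp0 := quadratic p _ _ _ _ _ (sin (PI / 2))) in *.
  replace qp0 with (2 * (c * tau) * ddy p (x', y', t)
    + quadratic p x' y' t (c * tau) (cos (3 * PI / 2)) (sin (3 * PI / 2))) by (rewrite <- Op; ring).
  field; lra.
Qed.

(** * From the slab to the moving frame *)

Definition extend (f : point -> R) (X : point) : R := f (fst X, Rmax 0 (snd X)).

Lemma extend_eq f x y t : 0 <= t -> extend f (x, y, t) = f (x, y, t).
Proof. intros Ht. unfold extend; simpl. now rewrite Rmax_right. Qed.

(** For interior t the interval is a neighbourhood of t, so restricting the filter to it changes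
    nothing. *)
Lemma is_derive_within_interior T (f : R -> R) t l : 0 < t < T ->
  is_derive_within (fun s => 0 <= s < T) f t l -> is_derive f t l.
Proof.
  intros Ht [Hl Hd]. split; [ exact Hl | ].
  intros x Hx.
  assert (E : t = x) by now apply (is_filter_lim_locally_unique t x).
  subst x. clear Hx.
  assert (L : locally t (fun s => 0 <= s < T)).
  { generalize (filter_and _ _
      (locally_gt (fun s : R => s) t 0 (continuous_id _) (proj1 Ht))
      (locally_lt (fun s : R => s) t T (continuous_id _) (proj2 Ht))).
    apply filter_imp; intros s []; lra. }
  intros eps.
  assert (F : is_filter_lim (within (fun s => 0 <= s < T) (locally t)) t).
  { intros P HP. now apply filter_le_within. }
  generalize (filter_and _ _ L (Hd t F eps)).
  apply filter_imp; intros s [H1 H2]; auto.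
Qed.

Lemma continuous_Rmax0 t : continuous (Rmax 0) t.
Proof.
  apply (continuous_ext (fun s => / 2 * s + / 2 * Rabs s)).
  - intros s. unfold Rmax. destruct (Rle_dec 0 s).
    + rewrite Rabs_right by lra. lra.
    + rewrite Rabs_left by lra. lra.
  - apply continuous_lincomb; [ apply continuous_id | apply continuous_Rabs ].
Qed.

Lemma smooth_extend k T : 0 < T -> forall f, class_C k T f -> smooth k T (extend f).
Proof.
  intros HT.
  (* Clamping time at 0 is continuous and sends the set t < T into the slab, so composition with it
     turns continuity relative to the slab into full continuity. *)
  assert (HC : forall f, continuous_on (slab T) f ->
    forall x y t, t < T -> continuous (extend f) (x, y, t)).
  { intros f Hf x y t Ht.
    assert (HS : slab T (x, y, Rmax 0 t)).
    { split; simpl; [ apply Rmax_l | now apply Rmax_lub_lt ]. }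
    apply (filterlim_comp _ _ _ (fun X : point => (fst X, Rmax 0 (snd X))) f
      (locally (x, y, t)) (within (slab T) (locally (x, y, Rmax 0 t)))
      (locally (f (x, y, Rmax 0 t)))); [ | now apply Hf ].
    intros P HP.
    assert (K : continuous (fun X : point => (fst X, Rmax 0 (snd X))) (x, y, t)).
    { apply continuous_pair; [ apply continuous_fst | ].
      apply (continuous_comp snd (Rmax 0)); [ apply continuous_snd | ].
      apply continuous_Rmax0. }
    assert (KP : locally (x, y, t) (fun X : point =>
      slab T (fst X, Rmax 0 (snd X)) -> P (fst X, Rmax 0 (snd X))))
      by exact (K (fun Y => slab T Y -> P Y) HP).
    change (locally (x, y, t) (fun X : point => P (fst X, Rmax 0 (snd X)))).
    generalize (filter_and _ _ KP
      (locally_lt (fun Y : point => snd Y) (x, y, t) T (continuous_coord3 _) Ht)).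
    apply filter_imp; intros X [H1 H2]. apply H1.
    split; simpl; [ apply Rmax_l | now apply Rmax_lub_lt ]. }
  induction k as [|k IH]; intros f Hf.
  - split; trivial. apply HC, Hf.
  - destruct Hf as (Cf & fx & fy & ft & Hg & Hx & Hy & Ht).
    assert (HG : forall x y t, t < T -> is_gradient T f (x, y, Rmax 0 t)
       (fx (x, y, Rmax 0 t)) (fy (x, y, Rmax 0 t)) (ft (x, y, Rmax 0 t))).
    { intros x y t Htt. apply Hg.
      split; simpl; [ apply Rmax_l | now apply Rmax_lub_lt ]. }
    apply smooth_S with (extend fx) (extend fy) (extend ft); auto.
    + intros x y t Htt. now destruct (HG x y t Htt) as (H & _ & _).
    + intros x y t Htt. now destruct (HG x y t Htt) as (_ & H & _).
    + intros x y t Htt. destruct (HG x y t (proj2 Htt)) as (_ & _ & H).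
      unfold extend; simpl. rewrite Rmax_right in H |- * by lra.
      apply is_derive_within_interior in H; trivial.
      apply is_derive_ext_loc with (2 := H).
      generalize (locally_gt (fun s : R => s) t 0 (continuous_id _) (proj1 Htt)).
      apply filter_imp; intros s Hs. now rewrite Rmax_right by lra.
Qed.

Definition co_moving (a b : R) (f : point -> R) : point -> R := moving_frame a b (extend f).

(** The equations only assert that some gradient exists at each point. Uniqueness of derivatives
    ties any such gradient to [ddx] and [ddy] in the moving frame, and the chain rule produces the
    material derivative in which the equations are written. *)
Lemma co_moving_gradient T f a b x y t fx fy ft :
  smooth 1 T (extend f) -> 0 < t < T ->
  is_gradient T f (x + a * t, y + b * t, t) fx fy ft ->
  ddx (co_moving a b f) (x, y, t) = fx /\ ddy (co_moving a b f) (x, y, t) = fy /\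
  is_derive (fun s => co_moving a b f (x, y, s)) t (ft + a * fx + b * fy).
Proof.
  intros Sf Ht (Hx & Hy & Htt).
  assert (Ex : ddx (extend f) (x + a * t, y + b * t, t) = fx).
  { apply is_derive_unique. apply is_derive_ext with (2 := Hx).
    intros s; symmetry; apply extend_eq; simpl; lra. }
  assert (Ey : ddy (extend f) (x + a * t, y + b * t, t) = fy).
  { apply is_derive_unique. apply is_derive_ext with (2 := Hy).
    intros s; symmetry; apply extend_eq; simpl; lra. }
  split; [ | split ].
  - rewrite <- Ex. apply is_derive_unique.
    exact (moving_frame_is_derive_x T (extend f) a b x y t Sf (proj2 Ht)).
  - rewrite <- Ey. apply is_derive_unique.
    exact (moving_frame_is_derive_y T (extend f) a b x y t Sf (proj2 Ht)).
  - replace (ft + a * fx + b * fy) with (a * fx + b * fy + ft) by ring.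
    rewrite <- Ex, <- Ey.
    apply (is_derive_spacetime_line T (extend f) a b x y t ft); trivial.
    apply is_derive_within_interior in Htt; trivial.
    apply is_derive_ext_loc with (2 := Htt).
    generalize (locally_gt (fun s : R => s) t 0 (continuous_id _) (proj1 Ht)).
    apply filter_imp; intros s Hs. symmetry; apply extend_eq; lra.
Qed.

Lemma euler_acoustic gamma rho' u' v' p' T rho u v p c :
  0 < rho' -> gamma * p' = rho' * c ^ 2 -> 0 < T ->
  class_C 3 T u -> class_C 3 T v -> class_C 3 T p ->
  linearized_euler_solution gamma rho' u' v' p' T rho u v p ->
  acoustic T rho' c (co_moving u' v' p) (co_moving u' v' u) (co_moving u' v' v).
Proof.
  intros Hr Hc HT Hu Hv Hp HE x y t Ht.
  destruct (HE (x + u' * t, y + v' * t, t)) as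
    (rx & ry & rt & ux & uy & ut & vx & vy & vt & px & py & pt &
     _ & Gu & Gv & Gp & _ & Eu & Ev & Ep); [ split; simpl; lra | ].
  apply co_moving_gradient in Gu as (-> & _ & Du); trivial;
    [ | now do 2 apply smooth_pred; apply smooth_extend ].
  apply co_moving_gradient in Gv as (_ & -> & Dv); trivial;
    [ | now do 2 apply smooth_pred; apply smooth_extend ].
  apply co_moving_gradient in Gp as (-> & -> & Dp); trivial;
    [ | now do 2 apply smooth_pred; apply smooth_extend ].
  unfold Rdiv in Eu, Ev; rewrite Rmult_1_l in Eu, Ev.
  split; [ | split ].
  - rewrite Hc in Ep.
    replace (- (rho' * c ^ 2) * ux + - (rho' * c ^ 2) * vy) with
      (pt + u' * px + v' * py) by lra.
    exact Dp.
  - replace (- / rho' * px) with (ut + u' * ux + v' * uy) by lra. exact Du.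
  - replace (- / rho' * py) with (vt + u' * vx + v' * vy) by lra. exact Dv.
Qed.

(* [rho - p / c^2] is constant along the characteristics of the mean flow. *)
Lemma entropy_transport gamma rho' u' v' p' T rho u v p c x y t tau :
  0 < c -> 0 < rho' -> gamma * p' = rho' * c ^ 2 ->
  smooth 1 T (extend rho) -> smooth 1 T (extend p) ->
  linearized_euler_solution gamma rho' u' v' p' T rho u v p ->
  0 <= t -> 0 < tau -> t + tau < T ->
  co_moving u' v' rho (x, y, t + tau) = co_moving u' v' rho (x, y, t)
    + 1 / c ^ 2 * (co_moving u' v' p (x, y, t + tau) - co_moving u' v' p (x, y, t)).
Proof.
  intros Hc Hr Hcc Srho Sp HE Ht Htau HT.
  set (w := fun s => 1 * co_moving u' v' rho (x, y, s + t)
                     + - (1 / c ^ 2) * co_moving u' v' p (x, y, s + t)).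
  (* A mean value bound with constant 0 gives constancy and includes t = 0, where only continuity of
     [w] is available. *)
  assert (B : Rabs (w tau - w 0) <= 0 * tau).
  { apply (mean_value_bound w (fun _ => 0)); trivial.
    - intros s Hs.
      assert (Hst : 0 < s + t < T) by lra.
      destruct (HE (x + u' * (s + t), y + v' * (s + t), s + t)) as
        (rx & ry & rt & ux & uy & ut & vx & vy & vt & px & py & pt &
         Gr & _ & _ & Gp & Er & _ & _ & Ep); [ split; simpl; lra | ].
      apply co_moving_gradient in Gr as (_ & _ & Dr); trivial.
      apply co_moving_gradient in Gp as (_ & _ & Dp); trivial.
      replace 0 with (1 * (rt + u' * rx + v' * ry)
                      + - (1 / c ^ 2) * (pt + u' * px + v' * py)).
      + refine (is_derive_shift (fun s => 1 * co_moving u' v' rho (x, y, s)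
                     + - (1 / c ^ 2) * co_moving u' v' p (x, y, s)) t s _ _).
        now apply is_derive_lincomb.
      (* Both material derivatives are multiples of the divergence, with factors [- rho'] and
         [- rho' * c ^ 2]; the weight [1 / c ^ 2] cancels them. *)
      + rewrite Hcc in Ep.
        replace (rt + u' * rx + v' * ry) with (- (rho' * (ux + vy))) by lra.
        replace (pt + u' * px + v' * py) with (- (rho' * c ^ 2 * (ux + vy))) by lra.
        field; lra.
    - intros s Hs.
      assert (CC : forall f, smooth 1 T (extend f) ->
        continuous (fun s => co_moving u' v' f (x, y, s + t)) s).
      { intros f Sf.
        apply (continuous_comp (fun s => s + t) (fun r => co_moving u' v' f (x, y, r))).
        - apply (continuous_plus (fun s : R => s) (fun _ => t));
            [ apply continuous_id | apply continuous_const ].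
        - apply continuous_in_time with T; [ | lra ].
          now apply smooth_moving_frame, smooth_pred. }
      apply continuous_lincomb; now apply CC.
    - intros s Hs. rewrite Rabs_R0; lra. }
  rewrite Rmult_0_l in B.
  assert (E : w tau - w 0 = 0).
  { destruct (Req_dec (w tau - w 0) 0) as [E|E]; trivial.
    apply Rabs_pos_lt in E; lra. }
  unfold w in E. rewrite Rplus_0_l, (Rplus_comm tau t) in E. lra.
Qed.

(** Uniformity in the base point allows that point to drift with tau without losing the cubic
    rate. *)
Lemma is_bigO_of_near (E : R -> R -> R -> R) (g : R -> R) x y a b :
  (exists r C, 0 < r /\ forall x' y' tau, near r x y x' y' -> 0 < tau < r ->
     Rabs (E x' y' tau) <= C * tau ^ 3) ->
  (forall tau, 0 < tau -> g tau = E (x - a * tau) (y - b * tau) tau) ->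
  is_bigO (at_right 0) g (fun tau => tau ^ 3).
Proof.
  intros (r & C & Hr & H) Hg. exists C.
  assert (Pa := Rabs_pos a). assert (Pb := Rabs_pos b).
  (* From [m * tau < r] follow both [tau < r] and a drift smaller than [r] in each coordinate. *)
  set (m := 1 + Rabs a + Rabs b).
  assert (Hm : 0 < r / m) by (apply Rdiv_lt_0_compat; unfold m; lra).
  exists (mkposreal _ Hm). intros tau Hball Htau.
  change (Rabs (tau - 0) < r / m) in Hball.
  rewrite Rminus_0_r, Rabs_right in Hball by lra.
  assert (Hmt : m * tau < r).
  { replace r with (m * (r / m)) by (field; unfold m; lra).
    apply Rmult_lt_compat_l; trivial. unfold m; lra. }
  unfold m in Hmt.
  rewrite Hg by trivial. rewrite (Rabs_right (tau ^ 3)) by (apply Rle_ge, pow_le; lra).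
  apply H; [ split | split; nra ].
  - replace (x - a * tau - x) with (- (a * tau)) by ring.
    rewrite Rabs_Ropp, Rabs_mult, (Rabs_right tau) by lra. nra.
  - replace (y - b * tau - y) with (- (b * tau)) by ring.
    rewrite Rabs_Ropp, Rabs_mult, (Rabs_right tau) by lra. nra.
Qed.

Theorem mainTheorem1 :
  forall (gamma rho' u' v' p' : R),
  1 < gamma -> 0 < rho' -> 0 < p' ->
  let c' := sqrt (gamma * p' / rho') in
  forall (T : R) (rho u v p : point -> R),
  class_C 3 T rho -> class_C 3 T u -> class_C 3 T v -> class_C 3 T p ->
  linearized_euler_solution gamma rho' u' v' p' T rho u v p ->
  forall x y t : R, 0 <= t < T ->
  let P (tau : R) : point := (x, y, t + tau) in
  let P' (tau : R) : point := (x - u' * tau, y - v' * tau, t) in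
  let Q (tau theta : R) : point :=
    (x - (u' - c' * cos theta) * tau, y - (v' - c' * sin theta) * tau, t) in
  is_bigO (at_right 0)
    (fun tau => p (P tau) -
      (- p (P' tau)
       + 1 / PI * RInt (fun theta => p (Q tau theta)) 0 (2 * PI)
       - rho' * c' / 2 * (u (Q tau 0) - u (Q tau PI))
       - rho' * c' / 2 * (v (Q tau (PI / 2)) - v (Q tau (3 * PI / 2)))))
    (fun tau => tau ^ 3) /\
  is_bigO (at_right 0)
    (fun tau => u (P tau) -
      (1 / PI * RInt (fun theta =>
           u (Q tau theta) * (2 * cos theta ^ 2 - 1 / 2)
           + 2 * v (Q tau theta) * sin theta * cos theta) 0 (2 * PI)
       - 1 / (2 * rho' * c') * (p (Q tau 0) - p (Q tau PI))))
    (fun tau => tau ^ 3) /\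
  is_bigO (at_right 0)
    (fun tau => v (P tau) -
      (1 / PI * RInt (fun theta =>
           v (Q tau theta) * (2 * sin theta ^ 2 - 1 / 2)
           + 2 * u (Q tau theta) * sin theta * cos theta) 0 (2 * PI)
       - 1 / (2 * rho' * c') * (p (Q tau (PI / 2)) - p (Q tau (3 * PI / 2)))))
    (fun tau => tau ^ 3) /\
  (forall tau : R, 0 < tau -> t + tau < T ->
     rho (P tau) = rho (P' tau) + 1 / c' ^ 2 * (p (P tau) - p (P' tau))).
Proof.
  intros gamma rho' u' v' p' Hgamma Hrho Hp' c' T rho u v p Srho Su Sv Sp HE
    x y t Ht P P' Q.
  assert (Hq : 0 < gamma * p' / rho') by (apply Rdiv_lt_0_compat; nra).
  assert (Hc : 0 < c') by now apply sqrt_lt_R0.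
  assert (Hcc : gamma * p' = rho' * c' ^ 2).
  { unfold c'. rewrite pow2_sqrt by lra. field; lra. }
  (* From here on the sound speed enters only through its positivity and [Hcc]. *)
  clearbody c'.
  assert (HT : 0 < T) by lra.
  assert (HA := euler_acoustic _ _ _ _ _ _ _ _ _ _ _ Hrho Hcc HT Su Sv Sp HE).
  assert (SM : forall f, class_C 3 T f -> smooth 3 T (co_moving u' v' f)).
  { intros f Hf. now apply smooth_moving_frame, smooth_extend. }
  (* In moving coordinates [P] and [P'] share their spatial position, at times t + tau and t. It is
     the fixed point (x - u' t, y - v' t) shifted by (- u' tau, - v' tau), the drift handled by
     [is_bigO_of_near]. *)
  assert (EP : forall f tau, 0 < tau -> f (P tau) =
    co_moving u' v' f (x - u' * t - u' * tau, y - v' * t - v' * tau, t + tau)).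
  { intros f tau Htau. unfold co_moving, moving_frame, extend, P; simpl.
    rewrite Rmax_right by lra. do 3 f_equal; ring. }
  assert (EP' : forall f tau, f (P' tau) =
    co_moving u' v' f (x - u' * t - u' * tau, y - v' * t - v' * tau, t)).
  { intros f tau. unfold co_moving, moving_frame, extend, P'; simpl.
    rewrite Rmax_right by lra. do 3 f_equal; ring. }
  assert (EQ : forall f tau th, f (Q tau th) =
    on_circle (co_moving u' v' f) (x - u' * t - u' * tau) (y - v' * t - v' * tau) t
      (c' * tau) th).
  { intros f tau th. unfold on_circle, co_moving, moving_frame, extend, Q; simpl.
    rewrite Rmax_right by lra. do 3 f_equal; ring. }
  split; [ | split; [ | split ] ].
  - eapply is_bigO_of_near;
      [ exact (pressure_evolution T rho' c' _ _ _ (x - u' * t) (y - v' * t) t HA Hrho Hc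
                 (SM p Sp) (SM u Su) (SM v Sv) Ht) | ].
    intros tau Htau. rewrite EP, EP', !EQ by trivial.
    do 5 f_equal. apply RInt_ext; intros; apply EQ.
  - eapply is_bigO_of_near;
      [ exact (velocity_x_evolution T rho' c' _ _ _ (x - u' * t) (y - v' * t) t HA Hrho Hc
                 (SM p Sp) (SM u Su) (SM v Sv) Ht) | ].
    intros tau Htau. rewrite EP, !EQ by trivial.
    do 3 f_equal. apply RInt_ext; intros; now rewrite !EQ.
  - eapply is_bigO_of_near;
      [ exact (velocity_y_evolution T rho' c' _ _ _ (x - u' * t) (y - v' * t) t HA Hrho Hc
                 (SM p Sp) (SM u Su) (SM v Sv) Ht) | ].
    intros tau Htau. rewrite EP, !EQ by trivial.
    do 3 f_equal. apply RInt_ext; intros; now rewrite !EQ.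
  - intros tau Htau Htt. rewrite !EP, !EP' by trivial.
    apply (entropy_transport gamma rho' u' v' p' T rho u v p); trivial; try lra.
    + now apply smooth_le1 with (k := 2%nat), smooth_extend.
    + now apply smooth_le1 with (k := 2%nat), smooth_extend.
Qed.
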